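(* Let $\gamma$ be an oval, let $F$ be its outer length billiard map, and fix an origin $O$ in the interior of $\gamma$. In polar coordinates $(\alpha,r)$ centered at $O$, consider the vector field $$X=-\frac{2w(\alpha)}{r}\,\frac{\partial}{\partial\alpha}$$ on $\mathbb{R}^2\setminus\{O\}$, and let $\Phi$ be its time-$1$ flow. Then there is a constant $C$, depending only on $\gamma$ and $O$, such that for every point $x$ in the exterior of $\gamma$, $$|F^2(x)-\Phi(x)|\le \frac{C}{|x|},$$ where $|x|$ denotes the distance from $x$ to $O$.
   Context: An oval is a smooth closed simple planar curve $\gamma$ with everywhere positive curvature; it bounds a compact strictly convex domain $K$. Orient $\gamma$ counterclockwise. For a point $A\in\mathbb{R}^2\setminus K$ there are exactly two lines through $A$ tangent to $\gamma$. The positive tangency point $x_+(A)$ is the one for which $x_+(A)-A$ is a positive multiple of the oriented tangent vector of $\gamma$ at $x_+(A)$. The negative tangency point $x_-(A)$ is the one for which $A-x_-(A)$ is a positive multiple of the oriented tangent vector of $\gamma$ at $x_-(A)$. Outer length billiard map $F:\mathbb{R}^2\setminus K\to\mathbb{R}^2\setminus K$. Let $\Sigma_A$ be the circle that is inscribed in the angle with vertex $A$ formed by the ray from $A$ through $x_+(A)$ and the ray from $A$ opposite to the ray from $A$ through $x_-(A)$, and that touches the first ray at $x_+(A)$. Then $\Sigma_A$ and $\gamma$ touch externally at $x_+(A)$. They have exactly three common tangent lines, two of which are the lines $Ax_+(A)$ and $Ax_-(A)$. $F(A)$ is the intersection point of the third common tangent line with the line $Ax_+(A)$. Width: for a direction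 $\alpha$, $w(\alpha)=w_\gamma(\alpha)$ is the distance between the two support lines of $\gamma$ parallel to the vector $(\cos\alpha,\sin\alpha)$. Note that $\partial/\partial\alpha$ has Euclidean length $r$, so $X$ moves points along circles centered at $O$ with speed $2w(\alpha)$. *)

(* Defs.v *)
From Stdlib Require Import Reals.
From Coquelicot Require Import Coquelicot.
Open Scope R_scope.

Definition pt := (R * R)%type.

Definition padd (p q : pt) : pt := (fst p + fst q, snd p + snd q).
Definition psub (p q : pt) : pt := (fst p - fst q, snd p - snd q).
Definition pscal (a : R) (p : pt) : pt := (a * fst p, a * snd p).
Definition pdot (p q : pt) : R := fst p * fst q + snd p * snd q.
Definition pdet (p q : pt) : R := fst p * snd q - snd p * fst q.
Definition pnorm (p : pt) : R := sqrt (pdot p p).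
Definition pdist (p q : pt) : R := pnorm (psub p q).

Definition gam (gx gy : R -> R) (t : R) : pt := (gx t, gy t).
Definition tang (gx gy : R -> R) (t : R) : pt := (Derive gx t, Derive gy t).
Definition accel (gx gy : R -> R) (t : R) : pt := (Derive_n gx 2 t, Derive_n gy 2 t).

(** An oval: a smooth (C^infty), L-periodic, simple closed curve with everywhere
    positive (signed) curvature, i.e. det(g', g'') > 0.  Positivity of the signed
    curvature also forces the parametrization to be regular and the orientation
    to be counterclockwise. *)
Definition is_oval (gx gy : R -> R) (L : R) : Prop :=
  0 < L /\
  (forall t, gx (t + L) = gx t /\ gy (t + L) = gy t) /\
  (forall n t, ex_derive_n gx n t /\ ex_derive_n gy n t) /\
  (forall s t, 0 <= s < L -> 0 <= t < L -> gam gx gy s = gam gx gy t -> s = t) /\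
  (forall t, 0 < pdet (tang gx gy t) (accel gx gy t)).

(** The compact convex domain K bounded by the (counterclockwise) oval:
    the points lying on the left of (or on) every oriented tangent line. *)
Definition inK (gx gy : R -> R) (x : pt) : Prop :=
  forall t, 0 <= pdet (tang gx gy t) (psub x (gam gx gy t)).

Definition in_interior (gx gy : R -> R) (x : pt) : Prop :=
  forall t, 0 < pdet (tang gx gy t) (psub x (gam gx gy t)).

Definition pos_tangency (gx gy : R -> R) (A : pt) (t : R) : Prop :=
  exists lam, 0 < lam /\ psub (gam gx gy t) A = pscal lam (tang gx gy t).

Definition neg_tangency (gx gy : R -> R) (A : pt) (s : R) : Prop :=
  exists mu, 0 < mu /\ psub A (gam gx gy s) = pscal mu (tang gx gy s).

(** The line through p with direction v equals the line through q with direction w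
    (v, w nonzero). *)
Definition same_line (p v q w : pt) : Prop :=
  pdet v w = 0 /\ pdet v (psub q p) = 0.

(** The circle with center c and radius rho is tangent to the line through p with
    direction v (v nonzero): distance from c to the line equals rho. *)
Definition circle_tangent_line (c : pt) (rho : R) (p v : pt) : Prop :=
  Rabs (pdet v (psub c p)) = rho * pnorm v.

(** Sigma_A: the circle (center c, radius rho) inscribed in the angle with vertex A
    formed by the ray from A through x_+ = gam t (direction tang t) and the ray from
    A opposite to the ray from A through x_- = gam s (direction tang s), touching the
    first ray at x_+. *)
Definition Sigma_circle (gx gy : R -> R) (A : pt) (t s : R) (c : pt) (rho : R) : Prop :=
  0 < rho /\
  (exists a b, 0 < a /\ 0 < b /\
     c = padd A (padd (pscal a (tang gx gy t)) (pscal b (tang gx gy s)))) /\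
  pdot (psub c (gam gx gy t)) (tang gx gy t) = 0 /\
  pdist c (gam gx gy t) = rho /\
  circle_tangent_line c rho A (tang gx gy s).

(** Outer length billiard map, as a relation: [olb_map gx gy A B] iff B = F(A).
    B is the intersection of the third common tangent line of Sigma_A and gamma
    (the tangent line of gamma at gam u, different from the lines A x_+ and A x_-)
    with the line A x_+. *)
Definition olb_map (gx gy : R -> R) (A B : pt) : Prop :=
  exists t s c rho u,
    pos_tangency gx gy A t /\ neg_tangency gx gy A s /\
    Sigma_circle gx gy A t s c rho /\
    circle_tangent_line c rho (gam gx gy u) (tang gx gy u) /\
    ~ same_line (gam gx gy u) (tang gx gy u) A (tang gx gy t) /\
    ~ same_line (gam gx gy u) (tang gx gy u) A (tang gx gy s) /\
    (exists tau, B = padd (gam gx gy u) (pscal tau (tang gx gy u))) /\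
    (exists sig, B = padd A (pscal sig (tang gx gy t))).

Definition support_fun (gx gy : R -> R) (theta : R) : R :=
  real (Lub_Rbar (fun v => exists t, v = cos theta * gx t + sin theta * gy t)).

(** Width w(alpha): distance between the two support lines of gamma parallel to
    (cos alpha, sin alpha), i.e. h(n) + h(-n) with n = (-sin alpha, cos alpha). *)
Definition width (gx gy : R -> R) (alpha : R) : R :=
  support_fun gx gy (alpha + PI / 2) + support_fun gx gy (alpha - PI / 2).

(** Time-1 flow of X = -(2 w(alpha) / r) d/d alpha in polar coordinates centered
    at O, as a relation: [flow1 gx gy O x y] iff y = Phi(x).  Along X the radius r
    is constant and d alpha / dt = -2 w(alpha) / r. *)
Definition flow1 (gx gy : R -> R) (O x y : pt) : Prop :=
  exists (r alpha0 : R) (a : R -> R),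
    0 < r /\
    x = padd O (pscal r (cos alpha0, sin alpha0)) /\
    a 0 = alpha0 /\
    (forall tau, is_derive a tau (- (2 * width gx gy (a tau)) / r)) /\
    y = padd O (pscal r (cos (a 1), sin (a 1))).

(* Main.v *)
(* Let [e t] be the unit tangent at [g t], [o] the parameter with opposite tangent, and
   let [(k, W)] be the coordinates of [g o - g t] in the frame of [e t], so that [W] is
   the width.  Write [x = g t - a e t] and [F x = g t + b e t].  A line of direction [f]
   tangent to [gamma] at [g u] is tangent to the circle of radius [rho] of the
   construction iff [det (f, g t - g u) = rho (1 + e t . f)].  With the half-angle
   parametrisation of [f] this becomes
   [2 b^2 = W rho + 2 k b + O(b^2 / rho)] for the third tangent line and
   [2 a^2 = W rho - 2 k a + O(a^2 / rho)] for the second one, whence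
   [b = a + k + O(1/a)].  So [F] is, up to [O(1/a)], the reflection
   [x |-> g t + g o - W rot90 (e t) - x], and composing two such reflections in nearly
   opposite directions moves [x] by [2 W rot90 (e t) + O(1/a)], which is the time-1
   displacement of the flow up to [O(1/|x|)].  Convexity comes from the interior point:
   the polar angle around it is increasing, a simple curve turns once around it, and the
   tangent turns as often as the radius. *)
Require Import Defs.
From Stdlib Require Import Reals Lra Psatz ZArith ClassicalEpsilon.
From Coquelicot Require Import Coquelicot.
Open Scope R_scope.

(** The radius [rho] is unknown, but both relations of the overview contain the same term [W rho].
    Their difference is divisible by [2 (a + b)] and leaves [b - a - k] with an error of order
    [(a + b) / rho]; this is [O(1/a)] because the relation for [a] also forces [rho] to be at least
    of order [a^2]. That works only far away, while [C] has to serve up to the curve: for [x] in a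
    bounded region, crude bounds on the two image points replace the asymptotics. The relational
    definition of [F] merely excludes two tangent lines, so it must be proved that the remaining one
    meets the line of [e t] beyond [g t], with [b > 0]. The estimates are stated for a
    [support_frame], a list of convexity properties with a single constant [M]. Nothing in [is_oval]
    says that the tangent turns exactly once, so these properties have to be extracted from
    simplicity. *)

Definition rot90 (v : pt) : pt := (- snd v, fst v).
Definition dir (a : R) : pt := (cos a, sin a).

Ltac unfold_pt :=
  unfold same_line, pdist, padd, psub, pscal, pdot, pdet, rot90, dir in *; cbn [fst snd] in *.

(** * Euclidean vectors in the plane and orthonormal frames *)

Lemma pair_ext (p q : pt) : fst p = fst q -> snd p = snd q -> p = q.
Proof. destruct p, q; cbn; intros -> ->; reflexivity. Qed.

Lemma pdot_self_ge0 v : 0 <= pdot v v.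
Proof. unfold_pt; nra. Qed.

Lemma pnorm_ge0 v : 0 <= pnorm v.
Proof. apply sqrt_pos. Qed.

Lemma pnorm_sqr v : pnorm v * pnorm v = pdot v v.
Proof. apply sqrt_sqrt, pdot_self_ge0. Qed.

Lemma pnorm_unit v : pdot v v = 1 -> pnorm v = 1.
Proof. unfold pnorm; intros ->; apply sqrt_1. Qed.

Lemma pnorm_scal a v : pnorm (pscal a v) = Rabs a * pnorm v.
Proof.
unfold pnorm.
replace (pdot (pscal a v) (pscal a v)) with (Rsqr a * pdot v v)
  by (unfold Rsqr; unfold_pt; ring).
rewrite sqrt_mult_alt by apply Rle_0_sqr.
now rewrite sqrt_Rsqr_abs.
Qed.

Lemma pnorm_rot90 v : pnorm (rot90 v) = pnorm v.
Proof. unfold pnorm; f_equal; unfold_pt; ring. Qed.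

Lemma Rabs_le_of_sqr x y : 0 <= y -> x * x <= y * y -> Rabs x <= y.
Proof. intros Hy Hxy; apply Rabs_le; split; nra. Qed.

Lemma pdet_le u v : Rabs (pdet u v) <= pnorm u * pnorm v.
Proof.
apply Rabs_le_of_sqr.
  now apply Rmult_le_pos; apply pnorm_ge0.
replace (pnorm u * pnorm v * (pnorm u * pnorm v))
  with ((pnorm u * pnorm u) * (pnorm v * pnorm v)) by ring.
rewrite !pnorm_sqr.
assert (H := Rle_0_sqr (pdot u v)); unfold Rsqr in H; unfold_pt; nra.
Qed.

Lemma pdot_le u v : Rabs (pdot u v) <= pnorm u * pnorm v.
Proof.
replace (pdot u v) with (pdet u (rot90 v)) by (unfold_pt; ring).
rewrite <- (pnorm_rot90 v); apply pdet_le.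
Qed.

Lemma pnorm_add u v : pnorm (padd u v) <= pnorm u + pnorm v.
Proof.
assert (H := pdot_le u v); apply Rabs_le_between in H.
assert (Hu := pnorm_sqr u); assert (Hv := pnorm_sqr v).
assert (Huv := pnorm_sqr (padd u v)).
replace (pdot (padd u v) (padd u v)) with (pdot u u + 2 * pdot u v + pdot v v) in Huv
  by (unfold_pt; ring).
assert (Pu := pnorm_ge0 u); assert (Pv := pnorm_ge0 v).
assert (Puv := pnorm_ge0 (padd u v)).
apply Rsqr_incr_0_var; [unfold Rsqr; nra | lra].
Qed.

Lemma pnorm_sub_sym u v : pnorm (psub u v) = pnorm (psub v u).
Proof. unfold pnorm; f_equal; unfold_pt; ring. Qed.

Lemma pnorm_sub u v : pnorm (psub u v) <= pnorm u + pnorm v.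
Proof.
replace (psub u v) with (padd u (pscal (-1) v)) by (apply pair_ext; unfold_pt; ring).
apply Rle_trans with (1 := pnorm_add _ _).
rewrite pnorm_scal, (Rabs_left (-1)); lra.
Qed.

Lemma pdist_triangle p q r : pdist p r <= pdist p q + pdist q r.
Proof.
replace (pdist p r) with (pnorm (padd (psub p q) (psub q r))).
  apply pnorm_add.
unfold pdist; f_equal; apply pair_ext; unfold_pt; ring.
Qed.

Lemma pdist_sym p q : pdist p q = pdist q p.
Proof. apply pnorm_sub_sym. Qed.

Lemma pdist_eq0 p q : pdist p q = 0 -> p = q.
Proof.
intros H; assert (H2 := pnorm_sqr (psub p q)); unfold pdist in H; rewrite H in H2.
apply pair_ext; apply Rminus_diag_uniq.
- apply (Rplus_sqr_eq_0 (fst p - fst q) (snd p - snd q)); unfold Rsqr; unfold_pt; lra.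
- apply (Rplus_sqr_eq_0 (fst p - fst q) (snd p - snd q)); unfold Rsqr; unfold_pt; lra.
Qed.

(** [pdot e v] and [pdet e v] are the coordinates of [v] in the orthonormal frame [(e, rot90 e)], in
    which the tangency conditions are computed. *)
Lemma pdet_frame e v w : pdot e e = 1 ->
  pdet v w = pdot e v * pdet e w - pdet e v * pdot e w.
Proof.
intros H; transitivity (pdot e e * pdet v w); [rewrite H|unfold_pt]; ring.
Qed.

Lemma pdot_frame e v w : pdot e e = 1 ->
  pdot v w = pdot e v * pdot e w + pdet e v * pdet e w.
Proof.
intros H; transitivity (pdot e e * pdot v w); [rewrite H|unfold_pt]; ring.
Qed.

Lemma frame_ext e v w : pdot e e = 1 ->
  pdot e v = pdot e w -> pdet e v = pdet e w -> v = w.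
Proof.
intros H H1 H2; apply pair_ext.
- transitivity (pdot e e * fst v); [rewrite H; ring|].
  transitivity (pdot e v * fst e - pdet e v * snd e); [unfold_pt; ring|].
  rewrite H1, H2; transitivity (pdot e e * fst w); [unfold_pt; ring|rewrite H; ring].
- transitivity (pdot e e * snd v); [rewrite H; ring|].
  transitivity (pdot e v * snd e + pdet e v * fst e); [unfold_pt; ring|].
  rewrite H1, H2; transitivity (pdot e e * snd w); [unfold_pt; ring|rewrite H; ring].
Qed.

(** * Unit vectors and their angles *)

Lemma unit_vector_dir x y : x * x + y * y = 1 -> exists a, x = cos a /\ y = sin a.
Proof.
intros H.
assert (Hx : -1 <= x <= 1) by nra.
assert (Hs : sqrt (1 - x²) = Rabs y).
  replace (1 - x²) with (y²) by (unfold Rsqr; lra); apply sqrt_Rsqr_abs.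
destruct (Rle_or_lt 0 y) as [Hy|Hy].
- exists (acos x); rewrite cos_acos, sin_acos, Hs by assumption.
  now rewrite Rabs_pos_eq.
- exists (- acos x); rewrite cos_neg, sin_neg, cos_acos, sin_acos, Hs by assumption.
  rewrite Rabs_left by assumption; lra.
Qed.

Lemma pdot_dir a : pdot (dir a) (dir a) = 1.
Proof. assert (H := sin2_cos2 a); unfold Rsqr in H; unfold_pt; lra. Qed.

Lemma abs_sin_le x : Rabs (sin x) <= Rabs x.
Proof.
destruct (MVT_gen sin 0 x cos) as (c & _ & Hc).
- intros y _; apply is_derive_Reals, derivable_pt_lim_sin.
- intros y _; apply continuity_sin.
- rewrite sin_0, !Rminus_0_r in Hc; rewrite Hc, Rabs_mult.
  assert (H := COS_bound c); assert (Rabs (cos c) <= 1) by (apply Rabs_le; lra).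
  assert (Px := Rabs_pos x); nra.
Qed.

Lemma one_minus_cos x : 1 - cos x = 2 * (sin (x / 2) * sin (x / 2)).
Proof.
replace x with (2 * (x / 2)) at 1 by field; rewrite cos_2a_sin; ring.
Qed.

Lemma pdist_dir_le a b : pdist (dir a) (dir b) <= Rabs (a - b).
Proof.
assert (H := pnorm_sqr (psub (dir a) (dir b))).
assert (E : pdot (psub (dir a) (dir b)) (psub (dir a) (dir b)) = 2 * (1 - cos (a - b))).
  rewrite cos_minus; assert (H1 := sin2_cos2 a); assert (H2 := sin2_cos2 b).
  unfold Rsqr in *; unfold_pt; lra.
rewrite E, one_minus_cos in H.
assert (Hs := abs_sin_le ((a - b) / 2)).
assert (P := pnorm_ge0 (psub (dir a) (dir b))).
assert (Hm : Rabs ((a - b) / 2) = Rabs (a - b) / 2).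
  unfold Rdiv; rewrite Rabs_mult, (Rabs_pos_eq (/ 2)); lra.
rewrite Hm in Hs.
assert (Hq : sin ((a - b) / 2) * sin ((a - b) / 2)
   = Rabs (sin ((a - b) / 2)) * Rabs (sin ((a - b) / 2))).
  rewrite <- Rabs_mult, Rabs_pos_eq; [reflexivity|nra].
assert (P2 := Rabs_pos (sin ((a - b) / 2))).
unfold pdist; apply Rsqr_incr_0_var; [unfold Rsqr; nra|apply Rabs_pos].
Qed.

(** From [x - x^3 / 6 <= sin x] and [x^2 <= 4]. *)
Lemma sin_lower x : 0 <= x <= 2 -> x / 3 <= sin x.
Proof.
intros Hx; destruct (pre_sin_bound x 0) as [H _]; try lra.
unfold sin_approx, sin_term in H; simpl in H.
assert (x * x <= 4) by nra; nra.
Qed.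

(** The chord is [2 |sin h|] with [h] half the angle, and [|h| <= PI / 2 <= 2] is in the range of
    [sin_lower]. It turns Lipschitz bounds in the tangent angle into bounds in the tangent
    vector. *)
Lemma chord_lower a b : - PI <= a - b <= PI -> Rabs (a - b) <= 3 * pdist (dir a) (dir b).
Proof.
intros H; assert (Hpi := PI_4).
assert (E : pdist (dir a) (dir b) * pdist (dir a) (dir b)
    = 4 * (sin ((a - b) / 2) * sin ((a - b) / 2))).
  unfold pdist; rewrite pnorm_sqr.
  transitivity (2 * (1 - cos (a - b))); [|rewrite one_minus_cos; ring].
  rewrite cos_minus; assert (H1 := sin2_cos2 a); assert (H2 := sin2_cos2 b).
  unfold Rsqr in *; unfold_pt; lra.
assert (P := pnorm_ge0 (psub (dir a) (dir b))); fold (pdist (dir a) (dir b)) in P.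
apply Rabs_le_of_sqr; [lra|].
set (h := (a - b) / 2) in *; replace (a - b) with (2 * h) by (unfold h; field).
assert (Hs : h / 3 * (h / 3) <= sin h * sin h).
  destruct (Rle_or_lt 0 h) as [Hh|Hh].
  - assert (S := sin_lower h ltac:(unfold h in *; lra)); nra.
  - assert (S := sin_lower (- h) ltac:(unfold h in *; lra)); rewrite sin_neg in S; nra.
nra.
Qed.

(** The remainder has components [cos h - 1] along [dir a] and [sin h - h] along its normal, each at
    most [h^2]. It replaces the arc described by the flow by a tangent segment. *)
Lemma dir_taylor a h :
  pnorm (psub (psub (dir (a + h)) (dir a)) (pscal h (rot90 (dir a)))) <= 2 * (h * h).
Proof.
assert (Hc : forall x, Rabs (cos x - 1) <= Rabs x).
  intros x; replace (cos x - 1) with (- (1 - cos x)) by ring.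
  rewrite Rabs_Ropp, one_minus_cos, Rabs_pos_eq by nra.
  assert (Hs := abs_sin_le (x / 2)); assert (Hb := SIN_bound (x / 2)).
  assert (Hm : Rabs (x / 2) = Rabs x / 2).
    unfold Rdiv; rewrite Rabs_mult, (Rabs_pos_eq (/ 2)); lra.
  rewrite Hm in Hs; revert Hs; unfold Rabs at 1; destruct Rcase_abs; nra.
assert (Hc2 : Rabs (cos h - 1) <= h * h).
  replace (cos h - 1) with (- (1 - cos h)) by ring.
  rewrite Rabs_Ropp, one_minus_cos, Rabs_pos_eq by nra.
  assert (Hs := abs_sin_le (h / 2)); apply Rsqr_le_abs_1 in Hs; unfold Rsqr in Hs; nra.
assert (Hs2 : Rabs (sin h - h) <= h * h).
  destruct (MVT_gen (fun x => sin x - x) 0 h (fun x => cos x - 1)) as (c & Hcb & Hce).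
  - intros y _; auto_derive; [trivial|ring].
  - intros y _; apply derivable_continuous_pt, derivable_pt_minus;
      [apply derivable_pt_sin|apply derivable_pt_id].
  - rewrite sin_0, !Rminus_0_r in Hce; rewrite Hce, Rabs_mult.
    assert (Hch : Rabs c <= Rabs h).
      revert Hcb; unfold Rmin, Rmax, Rabs; destruct Rle_dec, Rcase_abs, Rcase_abs; lra.
    assert (H := Hc c); assert (P := Rabs_pos h).
    replace (h * h) with (Rabs h * Rabs h) by (rewrite <- Rabs_mult, Rabs_pos_eq; nra).
    nra.
replace (psub (psub (dir (a + h)) (dir a)) (pscal h (rot90 (dir a))))
  with (padd (pscal (cos h - 1) (dir a)) (pscal (sin h - h) (rot90 (dir a)))).
  apply Rle_trans with (1 := pnorm_add _ _).
  rewrite !pnorm_scal, pnorm_rot90, (pnorm_unit _ (pdot_dir a)); lra.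
apply pair_ext; unfold_pt; [rewrite cos_plus|rewrite sin_plus]; ring.
Qed.

(** * The tangency equation *)

(* The line through [gu] directed by [f] meets the line through [gt] directed by [e]
   at [gt + beta e], where [beta = rho Z] and [Z] is the cotangent of half the angle
   from [e] to [f]; in terms of [Z] the tangency condition is quadratic. *)
Lemma tangent_quadratic e f gt gu go W k rho beta M D :
  pdot e e = 1 -> pdot f f = 1 -> 0 < rho -> 0 <= M ->
  W = pdet e (psub go gt) -> k = pdot e (psub go gt) ->
  0 <= pdet e (psub gu gt) -> pnorm (psub gu gt) <= D ->
  0 <= pdet f (psub go gu) <= M * (1 + pdot e f) ->
  pdet f (psub gt gu) = rho * (1 + pdot e f) ->
  pdet e f <> 0 ->
  pdet f (psub (padd gt (pscal beta e)) gu) = 0 ->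
  (Rabs beta <= D \/ Rabs beta <= rho) /\
  rho * Rabs (2 * (beta * beta) - W * rho - 2 * k * beta) <= (2 * M + Rabs W) * (beta * beta).
Proof.
intros He Hf Hrho HM HW Hk Hleft HD HE Hd Hf2 Hbeta.
assert (Hg1 : Rabs (pdot e (psub gu gt)) <= D).
  apply Rle_trans with (1 := pdot_le _ _); rewrite (pnorm_unit e He); lra.
assert (EHd : pdet f (psub gt gu) =
   pdet e f * pdot e (psub gu gt) - pdot e f * pdet e (psub gu gt)).
  rewrite (pdet_frame e f _ He); unfold_pt; ring.
assert (EHb : pdet f (psub (padd gt (pscal beta e)) gu) =
   pdet f (psub gt gu) - beta * pdet e f) by (unfold_pt; ring).
assert (EHE : pdet f (psub go gu) =
   pdet f (psub gt gu) + (pdot e f * W - pdet e f * k)).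
  rewrite HW, Hk, <- pdet_frame by assumption; unfold_pt; ring.
rewrite (pdot_frame e) in Hf by assumption.
set (E := pdet f (psub go gu)) in *; set (d := pdet f (psub gt gu)) in *.
set (g1 := pdot e (psub gu gt)) in *; set (g2 := pdet e (psub gu gt)) in *.
set (f1 := pdot e f) in *; set (f2 := pdet e f) in *.
rewrite EHb in Hbeta; clear EHb; clearbody E d g1 g2 f1 f2; clear He HD HW Hk.
set (Z := (1 + f1) / f2).
assert (H1 : 1 + f1 = Z * f2) by (unfold Z; field; assumption).
assert (Zb : beta = rho * Z).
  apply Rmult_eq_reg_r with f2; [|assumption].
  replace (beta * f2) with d by lra; rewrite Hd, H1; ring.
assert (Hz1 : f2 * (1 + Z * Z) = 2 * Z).
  apply Rmult_eq_reg_r with f2; [|assumption].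
  replace f1 with (Z * f2 - 1) in Hf by lra; lra.
assert (Hz2 : f1 * (1 + Z * Z) = Z * Z - 1).
  replace f1 with (Z * f2 - 1) by lra.
  replace ((Z * f2 - 1) * (1 + Z * Z)) with (Z * (f2 * (1 + Z * Z)) - (1 + Z * Z)) by ring.
  rewrite Hz1; ring.
split.
- destruct (Rle_or_lt 1 (Z * Z)) as [HZ|HZ].
  + left.
    assert (Hf1 : 0 <= f1) by nra.
    apply Rabs_le_between in Hg1; apply Rabs_le.
    (* [nu] is the signed length along [f] from the intersection point to the contact point [gu]. It
       has the sign of [beta], and [f1 >= 0], so [gu] projects at least as far along [e] as the
       intersection point. *)
    set (nu := g2 / f2).
    assert (Hnu : g2 = nu * f2) by (unfold nu; field; assumption).
    assert (Hb : g1 = beta + nu * f1).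
      apply Rmult_eq_reg_r with f2; [|assumption]; nra.
    destruct (Rdichotomy _ _ Hf2) as [Hs|Hs].
    * assert (nu <= 0) by nra; assert (Z <= 0) by nra; assert (beta <= 0) by nra; split; nra.
    * assert (0 <= nu) by nra; assert (0 <= Z) by nra; assert (0 <= beta) by nra; split; nra.
  + right; rewrite Zb, Rabs_mult, (Rabs_pos_eq rho) by lra.
    assert (Rabs Z <= 1) by (apply Rabs_le_of_sqr; lra).
    nra.
(* Multiplication by [1 + Z^2] turns [1 + f1], [f1], [f2] into [2 Z^2], [Z^2 - 1], [2 Z], and
   [rho Z] is [beta]. What remains besides the main terms is a multiple of [E], the distance from
   [go] to the tangent line, and a term of size [W rho Z^2]. *)
- assert (Hq : 2 * (beta * beta) - W * rho - 2 * k * beta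
     = rho * (E * (1 + Z * Z)) - W * (rho * (Z * Z))).
    rewrite EHE, Hd, Zb.
    replace (rho * ((rho * (1 + f1) + (f1 * W - f2 * k)) * (1 + Z * Z)))
      with (rho * (rho * ((1 + Z * Z) + f1 * (1 + Z * Z))
        + W * (f1 * (1 + Z * Z)) - k * (f2 * (1 + Z * Z)))) by ring.
    rewrite Hz1, Hz2; ring.
  rewrite Hq, <- (Rabs_pos_eq rho) at 1 by lra; rewrite <- Rabs_mult.
  assert (HEZ : 0 <= E * (1 + Z * Z) <= 2 * M * (Z * Z)).
    split; [nra|].
    replace (2 * M * (Z * Z)) with (M * ((1 + Z * Z) + f1 * (1 + Z * Z))) by (rewrite Hz2; ring).
    nra.
  assert (HWb := Rle_abs W); assert (HWb' := Rle_abs (- W)); rewrite Rabs_Ropp in HWb'.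
  set (m := E * (1 + Z * Z)) in *; clearbody m.
  set (Y := Z * Z) in *; assert (HY : 0 <= Y) by (unfold Y; nra).
  replace (rho * (rho * m - W * (rho * Y))) with (rho * rho * (m - W * Y)) by ring.
  replace (beta * beta) with (rho * rho * Y) by (rewrite Zb; unfold Y; ring).
  rewrite Rabs_mult, (Rabs_pos_eq (rho * rho)) by nra.
  replace ((2 * M + Rabs W) * (rho * rho * Y)) with (rho * rho * ((2 * M + Rabs W) * Y)) by ring.
  apply Rmult_le_compat_l; [nra|].
  apply Rabs_le; split; nra.
Qed.

(** Valid for every [a], hence usable near the curve. For [rho > K] the error terms are at most
    [b^2] and [a^2], and eliminating [W rho] leaves [b^2 - 2 D b <= 3 a^2 + 2 D a]; for [rho <= K]
    the alternative on [b] suffices. *)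
Lemma reflection_crude a b rho W k D K :
  0 < a -> 0 < b -> 0 < rho -> 0 < D -> 0 <= K ->
  Rabs k <= D ->
  (b <= D \/ b <= rho) ->
  rho * Rabs (2 * (b * b) - W * rho - 2 * k * b) <= K * (b * b) ->
  rho * Rabs (2 * (a * a) - W * rho + 2 * k * a) <= K * (a * a) ->
  b <= 2 * a + (4 * D + K).
Proof.
intros Ha Hb Hr HD HK Hk Hbr Eb Ea.
destruct (Rle_or_lt rho K) as [HrK|HrK].
  destruct Hbr; lra.
apply Rabs_le_between in Hk.
assert (Gb : Rabs (2 * (b * b) - W * rho - 2 * k * b) <= b * b).
  apply Rmult_le_reg_l with rho; [assumption|]; nra.
assert (Ga : Rabs (2 * (a * a) - W * rho + 2 * k * a) <= a * a).
  apply Rmult_le_reg_l with rho; [assumption|]; nra.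
apply Rabs_le_between in Ga; apply Rabs_le_between in Gb.
apply Rnot_lt_le; intros Hlt.
assert (b * b - 2 * D * b <= 3 * (a * a) + 2 * D * a) by nra.
nra.
Qed.

Lemma reflection_asymptotic a b rho W k D K :
  0 < a -> 0 < b -> 0 < rho -> 0 < D -> 0 <= K ->
  Rabs k <= D -> Rabs W <= D ->
  (a <= D \/ a <= rho) -> (b <= D \/ b <= rho) ->
  rho * Rabs (2 * (b * b) - W * rho - 2 * k * b) <= K * (b * b) ->
  rho * Rabs (2 * (a * a) - W * rho + 2 * k * a) <= K * (a * a) ->
  4 * D + K < a ->
  Rabs (b - a - k) <= 4 * K * D / a.
Proof.
intros Ha Hb Hr HD HK Hk HW Har Hbr Eb Ea Hlarge.
assert (Hb2 := reflection_crude a b rho W k D K Ha Hb Hr HD HK Hk Hbr Eb Ea).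
assert (Hra : a <= rho) by (destruct Har; lra).
apply Rabs_le_between in Hk; apply Rabs_le_between in HW.
assert (Ga : Rabs (2 * (a * a) - W * rho + 2 * k * a) <= a * a).
  apply Rmult_le_reg_l with rho; [assumption|]; nra.
apply Rabs_le_between in Ga.
(* The relation for [a] gives [W rho >= a^2 - 2 D a >= a^2 / 2], and [W <= D]. *)
assert (Hrho : a * a <= 2 * D * rho) by nra.
(* Subtracting the two relations cancels [W rho] and factors out [a + b]. *)
assert (Hsub : rho * (2 * (a + b) * Rabs (b - a - k)) <= K * ((a + b) * (a + b))).
  rewrite <- (Rabs_pos_eq (2 * (a + b))) by lra; rewrite <- Rabs_mult.
  replace (2 * (a + b) * (b - a - k)) with
    ((2 * (b * b) - W * rho - 2 * k * b) - (2 * (a * a) - W * rho + 2 * k * a)) by ring.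
  apply Rle_trans with (rho * (Rabs (2 * (b * b) - W * rho - 2 * k * b)
     + Rabs (2 * (a * a) - W * rho + 2 * k * a))).
    apply Rmult_le_compat_l; [lra|].
    unfold Rminus at 1; apply Rle_trans with (1 := Rabs_triang _ _).
    rewrite Rabs_Ropp; lra.
  assert (0 <= K * (a * b)) by (apply Rmult_le_pos; nra).
  rewrite Rmult_plus_distr_l; lra.
set (x := Rabs (b - a - k)) in *; assert (Hx : 0 <= x) by apply Rabs_pos; clearbody x.
assert (H1 : 2 * rho * x <= K * (a + b)).
  apply Rmult_le_reg_l with (a + b); [lra|]; nra.
assert (H2 : rho * x <= 2 * K * a) by nra.
apply Rmult_le_reg_r with a; [assumption|].
replace (4 * K * D / a * a) with (4 * K * D) by (field; lra).
apply Rmult_le_reg_r with a; [assumption|].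
nra.
Qed.

(** * One step of the map *)

(** The interface between the geometry of the oval and the estimates. [sf_osculating] compares the
    curve with a circle of radius [M], whose height above its tangent after a turn by [x] is
    [M (1 - cos x)]; it encodes the bound on the radius of curvature. *)
Record support_frame (g e : R -> pt) (M : R) : Prop := {
  sf_pos : 0 < M;
  sf_unit : forall t, pdot (e t) (e t) = 1;
  sf_onto : forall a, exists t, e t = dir a;
  sf_left : forall t u, 0 <= pdet (e u) (psub (g t) (g u));
  sf_osculating : forall t u,
    pdet (e u) (psub (g t) (g u)) <= M * (1 - pdot (e u) (e t));
  sf_strict : forall t u, pdet (e u) (psub (g t) (g u)) = 0 -> e t = e u;
  sf_lip : forall t u, pdist (g t) (g u) <= M * pdist (e t) (e u) }.

Lemma frame_opposite g e M t : support_frame g e M -> exists o, e o = pscal (-1) (e t).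
Proof.
intros H.
destruct (unit_vector_dir (- fst (e t)) (- snd (e t))) as [a [Ha1 Ha2]].
  rewrite <- (sf_unit _ _ _ H t); unfold_pt; ring.
destruct (sf_onto _ _ _ H a) as [o Ho]; exists o; rewrite Ho; apply pair_ext;
  unfold_pt; lra.
Qed.

(** Parameters are not reduced modulo the period, so contact points are identified through their
    tangent directions. *)
Lemma frame_same g e M t u : support_frame g e M -> e t = e u -> g t = g u.
Proof.
intros H E; apply pdist_eq0, Rle_antisym; [|apply pnorm_ge0].
apply Rle_trans with (1 := sf_lip _ _ _ H t u); rewrite E.
replace (pdist (e u) (e u)) with (Rabs 0 * pnorm (e u)).
  rewrite Rabs_R0; lra.
rewrite <- pnorm_scal; unfold pdist; f_equal; apply pair_ext; unfold_pt; ring.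
Qed.

Lemma frame_diam g e M t u : support_frame g e M -> pdist (g t) (g u) <= 2 * M.
Proof.
intros H; apply Rle_trans with (1 := sf_lip _ _ _ H t u).
assert (HM := sf_pos _ _ _ H).
assert (pdist (e t) (e u) <= 1 + 1).
  rewrite <- (pnorm_unit _ (sf_unit _ _ _ H t)) at 1.
  rewrite <- (pnorm_unit _ (sf_unit _ _ _ H u)) at 1.
  apply pnorm_sub.
nra.
Qed.

(* In the frame of [e], as [Z = (1 + f1) / f2] grows, tangency to the circle moves the
   intersection with the line of [e] one way and tangency to the curve the other way. *)
Lemma common_tangent_unique e f h gt gs gu rho :
  pdot e e = 1 -> pdot f f = 1 -> pdot h h = 1 -> 0 < rho ->
  pdet e f < 0 -> pdet e h < 0 ->
  0 <= pdet e (psub gs gt) -> 0 <= pdet e (psub gu gt) ->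
  0 <= pdet f (psub gu gs) -> 0 <= pdet h (psub gs gu) ->
  pdet f (psub gt gs) = rho * (1 + pdot e f) ->
  pdet h (psub gt gu) = rho * (1 + pdot e h) ->
  f = h.
Proof.
intros He Hf Hh Hrho Hf2 Hh2 Hx2 Hy2 Hfu Hhs Hfd Hhd.
assert (E1 : pdet f (psub gt gs) =
   pdet e f * pdot e (psub gs gt) - pdot e f * pdet e (psub gs gt)).
  rewrite (pdet_frame e f _ He); unfold_pt; ring.
assert (E2 : pdet h (psub gt gu) =
   pdet e h * pdot e (psub gu gt) - pdot e h * pdet e (psub gu gt)).
  rewrite (pdet_frame e h _ He); unfold_pt; ring.
assert (E3 : pdet f (psub gu gs) =
   pdot e f * pdet e (psub gu gt) - pdet e f * pdot e (psub gu gt) + pdet f (psub gt gs)).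
  rewrite <- pdet_frame by assumption; unfold_pt; ring.
assert (E4 : pdet h (psub gs gu) =
   pdot e h * pdet e (psub gs gt) - pdet e h * pdot e (psub gs gt) + pdet h (psub gt gu)).
  rewrite <- pdet_frame by assumption; unfold_pt; ring.
enough (Heq : pdot e f = pdot e h /\ pdet e f = pdet e h)
  by (apply (frame_ext e); tauto).
rewrite (pdot_frame e) in Hf by assumption; rewrite (pdot_frame e) in Hh by assumption.
set (x1 := pdot e (psub gs gt)) in *; set (x2 := pdet e (psub gs gt)) in *.
set (y1 := pdot e (psub gu gt)) in *; set (y2 := pdet e (psub gu gt)) in *.
set (f1 := pdot e f) in *; set (f2 := pdet e f) in *.
set (h1 := pdot e h) in *; set (h2 := pdet e h) in *.
rewrite E3, Hfd in Hfu; rewrite E4, Hhd in Hhs; rewrite Hfd in E1; rewrite Hhd in E2.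
clearbody x1 x2 y1 y2 f1 f2 h1 h2; clear Hfd Hhd E3 E4 He.
set (Zf := (1 + f1) / f2); set (Zh := (1 + h1) / h2).
assert (Ff : f1 = Zf * f2 - 1) by (unfold Zf; field; lra).
assert (Fh : h1 = Zh * h2 - 1) by (unfold Zh; field; lra).
assert (Hf2' : f2 * (1 + Zf * Zf) = 2 * Zf).
  apply Rmult_eq_reg_r with f2; [rewrite Ff in Hf; lra | lra].
assert (Hh2' : h2 * (1 + Zh * Zh) = 2 * Zh).
  apply Rmult_eq_reg_r with h2; [rewrite Fh in Hh; lra | lra].
assert (Zf0 : Zf < 0) by nra.
assert (Zh0 : Zh < 0) by nra.
set (Dl := f1 * h2 - f2 * h1).
(* [HA] and [HB] express that each contact point lies to the left of the tangent at the other one,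
   with the intersection points written as [rho Zf] and [rho Zh]. *)
assert (HA : y2 * Dl + rho * (f2 * h2) * (Zf - Zh) <= 0).
  replace (y2 * Dl + rho * (f2 * h2) * (Zf - Zh))
    with (h2 * (f1 * y2 - f2 * y1 + rho * (1 + f1))
      - f2 * (rho * (1 + h1) - (h2 * y1 - h1 * y2)))
    by (unfold Dl; rewrite Ff, Fh; ring).
  nra.
assert (HB : - (x2 * Dl) + rho * (f2 * h2) * (Zh - Zf) <= 0).
  replace (- (x2 * Dl) + rho * (f2 * h2) * (Zh - Zf))
    with (f2 * (h1 * x2 - h2 * x1 + rho * (1 + h1))
      - h2 * (rho * (1 + f1) - (f2 * x1 - f1 * x2)))
    by (unfold Dl; rewrite Ff, Fh; ring).
  nra.
(* [Dl = det (f, h)] has the sign of [Zf - Zh], since [1 + Zf Zh > 0]. So [HB] fails if [Zf < Zh],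
   and [HA] fails if [Zf > Zh]. *)
assert (HD : Dl * ((1 + Zf * Zf) * (1 + Zh * Zh)) = 2 * (Zf - Zh) * (1 + Zf * Zh)).
  replace (Dl * ((1 + Zf * Zf) * (1 + Zh * Zh)))
    with ((Zf * (f2 * (1 + Zf * Zf)) - (1 + Zf * Zf)) * (h2 * (1 + Zh * Zh))
      - (f2 * (1 + Zf * Zf)) * (Zh * (h2 * (1 + Zh * Zh)) - (1 + Zh * Zh)))
    by (unfold Dl; rewrite Ff, Fh; ring).
  rewrite Hf2', Hh2'; ring.
assert (HP : 0 < (1 + Zf * Zf) * (1 + Zh * Zh)) by (apply Rmult_lt_0_compat; nra).
set (P := (1 + Zf * Zf) * (1 + Zh * Zh)) in *.
assert (HN : 0 < 1 + Zf * Zh) by nra.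
assert (Hfh : 0 < rho * (f2 * h2)) by (apply Rmult_lt_0_compat; nra).
assert (EZ : Zf = Zh).
  destruct (Rtotal_order Zf Zh) as [Hlt|[Heq|Hgt]]; [exfalso | exact Heq | exfalso].
  - assert (Dl * P < 0) by (rewrite HD; nra); assert (Dl < 0) by nra.
    assert (0 < rho * (f2 * h2) * (Zh - Zf)) by (apply Rmult_lt_0_compat; lra); nra.
  - assert (0 < Dl * P) by (rewrite HD; nra); assert (0 < Dl) by nra.
    assert (0 < rho * (f2 * h2) * (Zf - Zh)) by (apply Rmult_lt_0_compat; lra); nra.
assert (E22 : f2 = h2).
  apply Rmult_eq_reg_r with (1 + Zf * Zf); [rewrite Hf2', EZ, Hh2'; ring | nra].
split; [rewrite Ff, Fh, EZ, E22; ring | exact E22].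
Qed.

Lemma circle_tangent_unit c rho p q f :
  0 < q -> pdot f f = 1 -> circle_tangent_line c rho p (pscal q f) ->
  Rabs (pdet f (psub c p)) = rho.
Proof.
unfold circle_tangent_line; intros Hq Hf.
replace (pdet (pscal q f) (psub c p)) with (q * pdet f (psub c p)) by (unfold_pt; ring).
rewrite pnorm_scal, Rabs_mult, (pnorm_unit f Hf), (Rabs_pos_eq q) by lra.
intros H; apply Rmult_eq_reg_l with q; lra.
Qed.

(* The coordinates of [g o - g t] in the frame of [e t]; [o] is meant to be the parameter
   with [e o = - e t]. *)
Definition opp_width (g e : R -> pt) (t o : R) : R := pdet (e t) (psub (g o) (g t)).
Definition opp_shift (g e : R -> pt) (t o : R) : R := pdot (e t) (psub (g o) (g t)).

Lemma same_line_frame e gu gt q1 q2 a :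
  gu = gt -> same_line gu (pscal q1 e) (psub gt (pscal a e)) (pscal q2 e).
Proof. intros ->; split; unfold_pt; ring. Qed.

(** Tangency to the circle is given by absolute values, so most of the work is to fix signs: the
    circle lies to the right of the tangent at [t] and to the left of those at [s] and [u]. Then
    [tangent_quadratic] applies to both of the latter. *)
Lemma olb_step gx gy q e M A B :
  support_frame (gam gx gy) e M ->
  (forall t, 0 < q t /\ tang gx gy t = pscal (q t) (e t)) ->
  olb_map gx gy A B ->
  exists t a b rho, 0 < a /\ 0 < b /\ 0 < rho /\
    A = psub (gam gx gy t) (pscal a (e t)) /\ B = padd (gam gx gy t) (pscal b (e t)) /\
    (a <= 2 * M \/ a <= rho) /\ (b <= 2 * M \/ b <= rho) /\
    forall o, e o = pscal (-1) (e t) ->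
      let W := opp_width (gam gx gy) e t o in
      let k := opp_shift (gam gx gy) e t o in
      rho * Rabs (2 * (b * b) - W * rho - 2 * k * b) <= (2 * M + Rabs W) * (b * b) /\
      rho * Rabs (2 * (a * a) - W * rho + 2 * k * a) <= (2 * M + Rabs W) * (a * a).
Proof.
intros HF HT (t & s & c & rho & u & (lam & Hlam & Hpos) & (mu & Hmu & Hneg)
  & (Hrho & (a1 & b1 & Ha1 & Hb1 & Hc) & Hperp & Hdist & Hcs) & Hcu & Hnt & Hns
  & (tau & HBu) & (sig & HBt)).
destruct (HT t) as [Hqt Tt]; destruct (HT s) as [Hqs Ts]; destruct (HT u) as [Hqu Tu].
rewrite Tt in *; rewrite Ts in *; rewrite Tu in *.
set (g := gam gx gy) in *.
assert (He := sf_unit _ _ _ HF t); assert (Hf := sf_unit _ _ _ HF s).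
assert (Hh := sf_unit _ _ _ HF u); assert (HM := sf_pos _ _ _ HF).
set (a := lam * q t); set (m := mu * q s).
assert (Ha : 0 < a) by (apply Rmult_lt_0_compat; assumption).
assert (Hm : 0 < m) by (apply Rmult_lt_0_compat; assumption).
assert (EA : A = psub (g t) (pscal a (e t))).
  apply (f_equal (psub (g t))) in Hpos.
  transitivity (psub (g t) (psub (g t) A)); [apply pair_ext; unfold_pt; ring|].
  rewrite Hpos; apply pair_ext; unfold a; unfold_pt; ring.
assert (EAs : A = padd (g s) (pscal m (e s))).
  apply (f_equal (padd (g s))) in Hneg.
  transitivity (padd (g s) (psub A (g s))); [apply pair_ext; unfold_pt; ring|].
  rewrite Hneg; apply pair_ext; unfold m; unfold_pt; ring.
assert (Egs : psub (g s) (g t) = psub (pscal (- a) (e t)) (pscal m (e s))).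
  transitivity (padd (psub (g s) A) (psub A (g t))); [apply pair_ext; unfold_pt; ring|].
  rewrite EA at 2; rewrite EAs; apply pair_ext; unfold_pt; ring.
(* Otherwise [g s] would lie on the tangent at [t] and coincide with [g t], although along that line
   [A] comes strictly before [g t] and strictly after [g s]. *)
assert (Hef : pdet (e t) (e s) < 0).
  assert (E : pdet (e t) (psub (g s) (g t)) = - m * pdet (e t) (e s)).
    rewrite Egs; unfold_pt; ring.
  assert (Hl := sf_left _ _ _ HF s t).
  destruct (Rle_or_lt 0 (pdet (e t) (e s))) as [H0|H0]; [exfalso|assumption].
  assert (Hz : pdet (e t) (psub (g s) (g t)) = 0) by (apply Rle_antisym; nra).
  assert (Hes := sf_strict _ _ _ HF _ _ Hz).
  assert (Hg := frame_same _ _ _ _ _ HF Hes).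
  assert (Hd : pdot (e t) (psub (g s) (g t)) = - a - m).
    rewrite Egs, Hes.
    transitivity ((- a - m) * pdot (e t) (e t)); [unfold_pt; ring|rewrite He; ring].
  rewrite Hg in Hd; unfold_pt; lra.
assert (Ec : c = padd (g t) (pscal (- rho) (rot90 (e t)))).
  assert (Hv1 : pdot (e t) (psub c (g t)) = 0).
    apply Rmult_eq_reg_l with (q t); [|lra].
    rewrite Rmult_0_r, <- Hperp; unfold_pt; ring.
  assert (Hv2 : pdet (e t) (psub c (g t)) = b1 * q s * pdet (e t) (e s)).
    rewrite Hc, EA; unfold_pt; ring.
  assert (Hb1s : 0 < b1 * q s) by (apply Rmult_lt_0_compat; assumption).
  assert (Hv3 := pnorm_sqr (psub c (g t))); fold (pdist c (g t)) in Hv3.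
  rewrite Hdist, (pdot_frame (e t)), Hv1 in Hv3 by assumption.
  assert (Hv4 : pdet (e t) (psub c (g t)) = - rho).
    assert (pdet (e t) (psub c (g t)) < 0) by (rewrite Hv2; nra).
    set (x := pdet (e t) (psub c (g t))) in *; clearbody x; nra.
  assert (Ev : psub c (g t) = pscal (- rho) (rot90 (e t))).
    apply (frame_ext (e t)); [assumption| |].
    - rewrite Hv1; unfold_pt; ring.
    - rewrite Hv4; transitivity (- rho * pdot (e t) (e t)); [rewrite He|unfold_pt]; ring.
  rewrite <- Ev; apply pair_ext; unfold_pt; ring.
assert (Hds : pdet (e s) (psub (g t) (g s)) = rho * (1 + pdot (e t) (e s))).
  apply circle_tangent_unit in Hcs; [|assumption|assumption].
  assert (Hp : 0 < pdet (e s) (psub c A)).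
    replace (pdet (e s) (psub c A)) with (a1 * q t * - pdet (e t) (e s))
      by (rewrite Hc; unfold_pt; ring).
    apply Rmult_lt_0_compat; [apply Rmult_lt_0_compat; assumption|lra].
  rewrite Rabs_pos_eq in Hcs by lra.
  assert (E : pdet (e s) (psub c A)
      = pdet (e s) (psub (g t) (g s)) - rho * pdot (e t) (e s)).
    rewrite EAs, Ec; unfold_pt; ring.
  lra.
assert (Hut : e u <> e t).
  intros E; apply Hnt; rewrite E, EA; apply same_line_frame.
  now apply (frame_same _ _ _ _ _ HF).
assert (Hdu : pdet (e u) (psub (g t) (g u)) = rho * (1 + pdot (e t) (e u))).
  apply circle_tangent_unit in Hcu; [|assumption|assumption].
  rewrite Ec in Hcu.
  replace (pdet (e u) (psub (padd (g t) (pscal (- rho) (rot90 (e t)))) (g u)))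
    with (pdet (e u) (psub (g t) (g u)) - rho * pdot (e t) (e u)) in Hcu
    by (unfold_pt; ring).
  destruct (Rcase_abs (pdet (e u) (psub (g t) (g u)) - rho * pdot (e t) (e u))) as [Hs|Hs].
  (* A circle to the right of the tangent at [u] touches the curve across it at [g t]; the tangent
     at [u] would then be the one at [t]. *)
  - rewrite Rabs_left in Hcu by assumption.
    assert (Hl := sf_left _ _ _ HF t u).
    assert (Hd := pdot_le (e t) (e u)); apply Rabs_le_between in Hd.
    rewrite !pnorm_unit in Hd by assumption.
    exfalso; apply Hut; symmetry; apply (sf_strict _ _ _ HF); nra.
  - rewrite Rabs_pos_eq in Hcu by lra; lra.
assert (Hh1 : pdot (e t) (e u) * pdot (e t) (e u) + pdet (e t) (e u) * pdet (e t) (e u) = 1).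
  now rewrite <- pdot_frame.
(* A negative sign makes the line the second tangent, by uniqueness. Of the two parallel cases,
   [e u = e t] is the first tangent and [e u = - e t] would put [g t] on the tangent at [u]. *)
assert (Heh : 0 < pdet (e t) (e u)).
  destruct (Rtotal_order (pdet (e t) (e u)) 0) as [Hlt|[Heq|Hgt]]; [exfalso|exfalso|exact Hgt].
  - assert (Efh : e s = e u).
      apply (common_tangent_unique (e t) (e s) (e u) (g t) (g s) (g u) rho);
        try assumption; apply (sf_left _ _ _ HF).
    apply Hns; rewrite <- Efh.
    replace (g u) with (g s) by (apply (frame_same _ _ _ _ _ HF); assumption).
    rewrite EAs; split; unfold_pt; ring.
  - rewrite Heq in Hh1.
    assert (Hcase : pdot (e t) (e u) = 1 \/ pdot (e t) (e u) = -1).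
      destruct (Rle_or_lt 0 (pdot (e t) (e u))); [left|right]; nra.
    destruct Hcase as [H1|H1].
    + apply Hut; apply (frame_ext (e t)); [assumption|rewrite He; assumption|].
      rewrite Heq; unfold_pt; ring.
    + apply Hut; symmetry; apply (sf_strict _ _ _ HF); rewrite Hdu, H1; ring.
set (b := sig * q t - a).
assert (EB : B = padd (g t) (pscal b (e t))).
  rewrite HBt, EA; apply pair_ext; unfold b; unfold_pt; ring.
assert (HBz : pdet (e u) (psub (padd (g t) (pscal b (e t))) (g u)) = 0).
  rewrite <- EB, HBu; unfold_pt; ring.
assert (Hb : 0 < b).
  assert (Hbd : b * pdet (e t) (e u) = rho * (1 + pdot (e t) (e u))).
    rewrite <- Hdu.
    transitivity (pdet (e u) (psub (g t) (g u))
      - pdet (e u) (psub (padd (g t) (pscal b (e t))) (g u))); [unfold_pt; ring|].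
    rewrite HBz; ring.
  assert (0 < 1 + pdot (e t) (e u)) by nra.
  assert (0 < b * pdet (e t) (e u)) by (rewrite Hbd; apply Rmult_lt_0_compat; assumption).
  nra.
assert (HAz : pdet (e s) (psub (padd (g t) (pscal (- a) (e t))) (g s)) = 0).
  transitivity (pdet (e s) (psub A (g s))); [rewrite EA; unfold_pt; ring|].
  rewrite EAs; unfold_pt; ring.
assert (Hosc : forall o v, e o = pscal (-1) (e t) ->
    0 <= pdet (e v) (psub (g o) (g v)) <= M * (1 + pdot (e t) (e v))).
  intros o v Ho; split; [apply (sf_left _ _ _ HF)|].
  apply Rle_trans with (1 := sf_osculating _ _ _ HF o v).
  rewrite Ho; apply Req_le; unfold_pt; ring.
assert (Qu : forall o, e o = pscal (-1) (e t) -> _) by exact (fun o Ho =>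
  tangent_quadratic (e t) (e u) (g t) (g u) (g o) _ _ rho b M (2 * M) He Hh Hrho
    (Rlt_le _ _ HM) eq_refl eq_refl (sf_left _ _ _ HF u t) (frame_diam _ _ _ u t HF)
    (Hosc o u Ho) Hdu (Rgt_not_eq _ _ Heh) HBz).
(* The second tangent meets the line of [e t] at [A = g t - a e t], so here [beta = - a]. *)
assert (Qs : forall o, e o = pscal (-1) (e t) -> _) by exact (fun o Ho =>
  tangent_quadratic (e t) (e s) (g t) (g s) (g o) _ _ rho (- a) M (2 * M) He Hf Hrho
    (Rlt_le _ _ HM) eq_refl eq_refl (sf_left _ _ _ HF s t) (frame_diam _ _ _ s t HF)
    (Hosc o s Ho) Hds (Rlt_not_eq _ _ Hef) HAz).
destruct (frame_opposite _ _ _ t HF) as [o0 Ho0].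
exists t, a, b, rho; repeat split; try assumption.
- destruct (Qs o0 Ho0) as [H _]; rewrite Rabs_Ropp, Rabs_pos_eq in H by lra; exact H.
- destruct (Qu o0 Ho0) as [H _]; rewrite Rabs_pos_eq in H by lra; exact H.
- apply (Qu o H).
- destruct (Qs o H) as [_ H2]; unfold opp_width, opp_shift.
  replace (- a * - a) with (a * a) in H2 by ring.
  replace (2 * (a * a) - pdet (e t) (psub (g o) (g t)) * rho +
    2 * pdot (e t) (psub (g o) (g t)) * a)
   with (2 * (a * a) - pdet (e t) (psub (g o) (g t)) * rho -
    2 * pdot (e t) (psub (g o) (g t)) * - a) by ring.
  exact H2.
Qed.

(** * Two steps of the map and the flow *)

Lemma opp_width_bound g e M t o :
  support_frame g e M -> Rabs (opp_width g e t o) <= 2 * M.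
Proof.
intros HF; apply Rle_trans with (1 := pdet_le _ _).
rewrite (pnorm_unit _ (sf_unit _ _ _ HF t)), Rmult_1_l; apply (frame_diam _ _ _ o t HF).
Qed.

Lemma opp_shift_bound g e M t o :
  support_frame g e M -> Rabs (opp_shift g e t o) <= 2 * M.
Proof.
intros HF; apply Rle_trans with (1 := pdot_le _ _).
rewrite (pnorm_unit _ (sf_unit _ _ _ HF t)), Rmult_1_l; apply (frame_diam _ _ _ o t HF).
Qed.

Lemma opp_width_sym g e t o :
  e o = pscal (-1) (e t) -> opp_width g e o t = opp_width g e t o.
Proof. unfold opp_width; intros ->; unfold_pt; ring. Qed.

Lemma opp_width_lip g e M t o t' o' :
  support_frame g e M -> e o = pscal (-1) (e t) -> e o' = pscal (-1) (e t') ->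
  Rabs (opp_width g e t' o' - opp_width g e t o) <= 4 * M * pdist (e t') (e t).
Proof.
intros HF Ho Ho'; unfold opp_width.
(* Turning [e t] costs at most the diameter [2 M] per unit, and each of the two contact points moves
   by at most [M] times the turn. *)
replace (pdet (e t') (psub (g o') (g t')) - pdet (e t) (psub (g o) (g t)))
  with (pdet (psub (e t') (e t)) (psub (g o') (g t'))
    + pdet (e t) (psub (psub (g o') (g o)) (psub (g t') (g t)))) by (unfold_pt; ring).
apply Rle_trans with (1 := Rabs_triang _ _).
assert (H1 := pdet_le (psub (e t') (e t)) (psub (g o') (g t'))).
assert (H2 := pdet_le (e t) (psub (psub (g o') (g o)) (psub (g t') (g t)))).
rewrite (pnorm_unit _ (sf_unit _ _ _ HF t)) in H2.
assert (H3 := pnorm_sub (psub (g o') (g o)) (psub (g t') (g t))).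
assert (H4 := frame_diam _ _ _ o' t' HF).
assert (H5 := sf_lip _ _ _ HF o' o); assert (H6 := sf_lip _ _ _ HF t' t).
replace (pdist (e o') (e o)) with (pdist (e t') (e t)) in H5
  by (rewrite Ho, Ho', pdist_sym; unfold pdist; f_equal; apply pair_ext; unfold_pt; ring).
assert (H7 := pnorm_ge0 (psub (e t') (e t))).
unfold pdist in *; nra.
Qed.

(** Two rays from one far point to points a bounded distance apart: [b e + a e'] is the difference
    of those points. It serves for successive contact points seen from [F x], and for the origin and
    the contact point seen from [x]. *)
Lemma nearly_opposite e e' a b D :
  pdot e e = 1 -> pdot e' e' = 1 -> 0 <= a -> 0 <= b ->
  pnorm (padd (pscal b e) (pscal a e')) <= D ->
  Rabs (b - a) <= D /\ b * pnorm (padd e e') <= 2 * D.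
Proof.
intros He He' Ha Hb HD.
assert (Ne := pnorm_unit e He); assert (Ne' := pnorm_unit e' He').
assert (H1 : pnorm (pscal b e) <= D + a).
  replace (pscal b e) with (psub (padd (pscal b e) (pscal a e')) (pscal a e'))
    by (apply pair_ext; unfold_pt; ring).
  apply Rle_trans with (1 := pnorm_sub _ _).
  rewrite (pnorm_scal a), Ne', Rabs_pos_eq; lra.
assert (H2 : pnorm (pscal a e') <= D + b).
  replace (pscal a e') with (psub (padd (pscal b e) (pscal a e')) (pscal b e))
    by (apply pair_ext; unfold_pt; ring).
  apply Rle_trans with (1 := pnorm_sub _ _).
  rewrite (pnorm_scal b), Ne, Rabs_pos_eq; lra.
rewrite pnorm_scal, Ne, Rabs_pos_eq in H1 by assumption.
rewrite pnorm_scal, Ne', Rabs_pos_eq in H2 by assumption.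
assert (H3 : Rabs (b - a) <= D) by (apply Rabs_le; lra).
split; [assumption|].
rewrite <- (Rabs_pos_eq b) by assumption; rewrite <- pnorm_scal.
replace (pscal b (padd e e'))
  with (padd (padd (pscal b e) (pscal a e')) (pscal (b - a) e'))
  by (apply pair_ext; unfold_pt; ring).
apply Rle_trans with (1 := pnorm_add _ _).
rewrite (pnorm_scal (b - a)), Ne'; lra.
Qed.

Lemma olb_reflection gx gy q e M A B :
  support_frame (gam gx gy) e M ->
  (forall t, 0 < q t /\ tang gx gy t = pscal (q t) (e t)) ->
  olb_map gx gy A B ->
  exists t a b, 0 < a /\ 0 < b /\
    A = psub (gam gx gy t) (pscal a (e t)) /\ B = padd (gam gx gy t) (pscal b (e t)) /\
    b <= 2 * a + 12 * M /\
    (12 * M < a -> forall o, e o = pscal (-1) (e t) ->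
       Rabs (b - a - opp_shift (gam gx gy) e t o) <= 32 * (M * M) / a).
Proof.
intros HF HT HAB.
destruct (olb_step _ _ _ _ _ _ _ HF HT HAB)
  as (t & a & b & rho & Ha & Hb & Hrho & EA & EB & Har & Hbr & HQ).
exists t, a, b; repeat split; try assumption.
- destruct (frame_opposite _ _ _ t HF) as [o Ho].
  destruct (HQ o Ho) as [Qb Qa].
  assert (HW := opp_width_bound _ _ _ t o HF); assert (Hk := opp_shift_bound _ _ _ t o HF).
  set (W := opp_width (gam gx gy) e t o) in *; set (k := opp_shift (gam gx gy) e t o) in *.
  assert (HM := sf_pos _ _ _ HF).
  (* Here [D = 2 M], and [4 M] bounds the factor [2 M + |W|]. *)
  replace (12 * M) with (4 * (2 * M) + 4 * M) by ring.
  apply reflection_crude with rho W k; try assumption; try lra; nra.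
- intros Hbig o Ho.
  destruct (HQ o Ho) as [Qb Qa].
  assert (HW := opp_width_bound _ _ _ t o HF); assert (Hk := opp_shift_bound _ _ _ t o HF).
  set (W := opp_width (gam gx gy) e t o) in *; set (k := opp_shift (gam gx gy) e t o) in *.
  assert (HM := sf_pos _ _ _ HF).
  replace (32 * (M * M)) with (4 * (4 * M) * (2 * M)) by ring.
  apply reflection_asymptotic with rho W; try assumption; try lra; nra.
Qed.

(* Each step is, up to [O(1/a)], the reflection [A |-> S(t) - A] with
   [S(t) = g t + g o - W rot90 (e t)]; [S] changes by [2 W rot90 (e t)], up to
   [O(1/a)], from one step to the next. *)
Lemma olb_two_steps gx gy q e M A B Z :
  support_frame (gam gx gy) e M ->
  (forall t, 0 < q t /\ tang gx gy t = pscal (q t) (e t)) ->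
  olb_map gx gy A B -> olb_map gx gy B Z ->
  exists t a, 0 < a /\ A = psub (gam gx gy t) (pscal a (e t)) /\
    pdist Z (gam gx gy t) <= 4 * a + 42 * M /\
    (100 * M < a -> forall o, e o = pscal (-1) (e t) ->
      pdist Z (padd A (pscal (2 * opp_width (gam gx gy) e t o) (rot90 (e t))))
        <= 160 * (M * M) / a).
Proof.
intros HF HT HAB HBZ.
destruct (olb_reflection _ _ _ _ _ _ _ HF HT HAB)
  as (t & a & b & Ha & Hb & EA & EB & Hcr & Has).
destruct (olb_reflection _ _ _ _ _ _ _ HF HT HBZ)
  as (t' & a' & b' & Ha' & Hb' & EB' & EZ & Hcr' & Has').
set (g := gam gx gy) in *.
assert (HM := sf_pos _ _ _ HF).
assert (He := sf_unit _ _ _ HF t); assert (He' := sf_unit _ _ _ HF t').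
destruct (nearly_opposite (e t) (e t') a' b (2 * M)) as [Hba Heps]; try assumption; try lra.
  replace (padd (pscal b (e t)) (pscal a' (e t'))) with (psub (g t') (g t)).
    apply (frame_diam _ _ _ t' t HF).
  transitivity (psub (psub (g t') (psub (g t') (pscal a' (e t')))) (psub (g t) B)).
    rewrite <- EB'; apply pair_ext; unfold_pt; ring.
  rewrite EB; apply pair_ext; unfold_pt; ring.
apply Rabs_le_between in Hba.
exists t, a; repeat split; try assumption.
- apply Rle_trans with (1 := pdist_triangle _ (g t') _).
  assert (H1 := frame_diam _ _ _ t' t HF).
  replace (pdist Z (g t')) with (pnorm (pscal b' (e t'))).
    rewrite pnorm_scal, pnorm_unit, Rabs_pos_eq by (assumption || lra); lra.
  rewrite EZ; unfold pdist; f_equal; apply pair_ext; unfold_pt; ring.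
- intros Hbig o Ho.
  destruct (frame_opposite _ _ _ t' HF) as [o' Ho'].
  assert (H1 := Has ltac:(lra) o Ho).
  assert (Hk := opp_shift_bound _ _ _ t o HF).
  assert (Hinv : 32 * (M * M) / a <= M).
    apply Rmult_le_reg_r with a; [assumption|].
    unfold Rdiv; rewrite Rmult_assoc, Rinv_l by lra; nra.
  assert (Hba1 : a / 2 <= b).
    apply Rabs_le_between in H1; apply Rabs_le_between in Hk; lra.
  assert (Hba2 : a / 2 <= a').
    apply Rabs_le_between in H1; apply Rabs_le_between in Hk; lra.
  assert (H2 := Has' ltac:(lra) o' Ho').
  assert (H2' : 32 * (M * M) / a' <= 64 * (M * M) / a).
    apply Rmult_le_reg_r with (a * a'); [nra|].
    replace (32 * (M * M) / a' * (a * a')) with (32 * (M * M) * a) by (field; lra).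
    replace (64 * (M * M) / a * (a * a')) with (64 * (M * M) * a') by (field; lra).
    nra.
  (* [eps] measures how far [t'] is from [o] in direction, and equally [o'] from [t]. *)
  set (eps := pnorm (padd (e t) (e t'))) in *.
  assert (Heps0 : 0 <= eps) by apply pnorm_ge0.
  assert (Heps1 : eps <= 8 * M / a).
    apply Rmult_le_reg_r with a; [assumption|].
    replace (8 * M / a * a) with (8 * M) by (field; lra); nra.
  assert (Hg1 : pdist (g t') (g o) <= M * eps).
    replace eps with (pdist (e t') (e o)); [apply (sf_lip _ _ _ HF)|].
    rewrite Ho; unfold eps, pdist; f_equal; apply pair_ext; unfold_pt; ring.
  assert (Hg2 : pdist (g o') (g t) <= M * eps).
    replace eps with (pdist (e t) (e o')).
      rewrite (pdist_sym (e t)); apply (sf_lip _ _ _ HF).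
    rewrite Ho'; unfold eps, pdist; f_equal; apply pair_ext; unfold_pt; ring.
  assert (HWl : Rabs (opp_width g e t' o' - opp_width g e t o) <= 4 * M * eps).
    rewrite <- (opp_width_sym g e t o Ho).
    replace eps with (pdist (e t') (e o)).
      apply opp_width_lip; try assumption.
      rewrite Ho; apply pair_ext; unfold_pt; ring.
    rewrite Ho; unfold eps, pdist; f_equal; apply pair_ext; unfold_pt; ring.
  assert (HW := opp_width_bound _ _ _ t o HF).
  set (W := opp_width g e t o) in *; set (W' := opp_width g e t' o') in *.
  set (k := opp_shift g e t o) in *; set (k' := opp_shift g e t' o') in *.
  assert (Sk : padd (pscal k (e t)) (pscal W (rot90 (e t))) = psub (g o) (g t)).
    apply (frame_ext (e t)); [assumption| |].
    - transitivity (k * pdot (e t) (e t)); [unfold_pt; ring|rewrite He; unfold k, opp_shift; ring].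
    - transitivity (W * pdot (e t) (e t)); [unfold_pt; ring|rewrite He; unfold W, opp_width; ring].
  assert (Sk' : padd (pscal k' (e t')) (pscal W' (rot90 (e t'))) = psub (g o') (g t')).
    apply (frame_ext (e t')); [assumption| |].
    - transitivity (k' * pdot (e t') (e t'));
        [unfold_pt; ring|rewrite He'; unfold k', opp_shift; ring].
    - transitivity (W' * pdot (e t') (e t'));
        [unfold_pt; ring|rewrite He'; unfold W', opp_width; ring].
  assert (Ego : g o = padd (g t) (padd (pscal k (e t)) (pscal W (rot90 (e t))))).
    rewrite Sk; apply pair_ext; unfold_pt; ring.
  assert (Ego' : g o' = padd (g t') (padd (pscal k' (e t')) (pscal W' (rot90 (e t'))))).
    rewrite Sk'; apply pair_ext; unfold_pt; ring.
  assert (EBB : padd (g t) (pscal b (e t)) = psub (g t') (pscal a' (e t')))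
    by now rewrite <- EB.
  (* [Ego] and [Ego'] remove the shifts, and [EBB] removes the intermediate point. What remains is
     the two reflection errors ([32] and [64]) and terms bounded in total by [8 M eps]. *)
  assert (Hsum : psub Z (padd A (pscal (2 * W) (rot90 (e t)))) =
    padd (psub (pscal (b' - a' - k') (e t')) (pscal (b - a - k) (e t)))
     (psub (padd (psub (g t') (g o)) (psub (g o') (g t)))
       (padd (pscal (W' - W) (rot90 (e t'))) (pscal W (rot90 (padd (e t) (e t'))))))).
    rewrite EZ, EA, Ego, Ego'.
    apply pair_ext.
    - apply (f_equal fst) in EBB; unfold_pt; lra.
    - apply (f_equal snd) in EBB; unfold_pt; lra.
  unfold pdist; rewrite Hsum.
  apply Rle_trans with (1 := pnorm_add _ _).
  assert (B1 := pnorm_sub (pscal (b' - a' - k') (e t')) (pscal (b - a - k) (e t))).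
  rewrite !pnorm_scal, (pnorm_unit _ He), (pnorm_unit _ He') in B1.
  assert (B2 := pnorm_sub (padd (psub (g t') (g o)) (psub (g o') (g t)))
       (padd (pscal (W' - W) (rot90 (e t'))) (pscal W (rot90 (padd (e t) (e t')))))).
  assert (B3 := pnorm_add (psub (g t') (g o)) (psub (g o') (g t))).
  assert (B4 := pnorm_add (pscal (W' - W) (rot90 (e t'))) (pscal W (rot90 (padd (e t) (e t'))))).
  rewrite !pnorm_scal, !pnorm_rot90 in B4; rewrite (pnorm_unit (e t')) in B4 by assumption.
  fold eps in B4.
  assert (B5 : Rabs W * eps <= 2 * M * eps) by (apply Rmult_le_compat_r; assumption).
  assert (B6 : M * eps <= M * (8 * M / a)) by (apply Rmult_le_compat_l; lra).
  replace (160 * (M * M) / a) with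
    (64 * (M * M) / a + 32 * (M * M) / a + 8 * (M * (8 * M / a))) by (field; lra).
  unfold pdist in Hg1, Hg2; lra.
Qed.

(** * Width as the distance between opposite tangents *)

Lemma support_fun_max gx gy th m :
  (forall t, cos th * gx t + sin th * gy t <= cos th * gx m + sin th * gy m) ->
  support_fun gx gy th = cos th * gx m + sin th * gy m.
Proof.
intros H; unfold support_fun.
rewrite (is_lub_Rbar_unique _ (Finite (cos th * gx m + sin th * gy m))); [reflexivity|].
split.
- intros v [t ->]; apply H.
- intros v Hv; apply Hv; now exists m.
Qed.

(** The curve lies to the left of both opposite tangents, so the two suprema are attained at [o] and
    [t]. *)
Lemma width_opp gx gy e M al t o :
  support_frame (gam gx gy) e M -> e t = dir al -> e o = pscal (-1) (e t) ->
  width gx gy al = opp_width (gam gx gy) e t o.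
Proof.
intros HF Ht Ho; unfold width.
assert (C1 : cos (al + PI / 2) = - sin al)
  by (rewrite cos_plus, cos_PI2, sin_PI2; ring).
assert (S1 : sin (al + PI / 2) = cos al)
  by (rewrite sin_plus, cos_PI2, sin_PI2; ring).
assert (C2 : cos (al - PI / 2) = sin al)
  by (rewrite cos_minus, cos_PI2, sin_PI2; ring).
assert (S2 : sin (al - PI / 2) = - cos al)
  by (rewrite sin_minus, cos_PI2, sin_PI2; ring).
rewrite (support_fun_max gx gy (al + PI / 2) o), (support_fun_max gx gy (al - PI / 2) t).
- rewrite C1, S1, C2, S2; unfold opp_width; rewrite Ht; unfold gam; unfold_pt; ring.
- intros v; rewrite C2, S2; assert (H := sf_left _ _ _ HF v t); rewrite Ht in H.
  unfold gam in H; unfold_pt; lra.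
- intros v; rewrite C1, S1; assert (H := sf_left _ _ _ HF v o); rewrite Ho, Ht in H.
  unfold gam in H; unfold_pt; lra.
Qed.

Lemma width_bound gx gy e M al :
  support_frame (gam gx gy) e M -> Rabs (width gx gy al) <= 2 * M.
Proof.
intros HF; destruct (sf_onto _ _ _ HF al) as [t Ht].
destruct (frame_opposite _ _ _ t HF) as [o Ho].
rewrite (width_opp gx gy e M al t o) by assumption; now apply opp_width_bound.
Qed.

Lemma width_lip gx gy e M al be :
  support_frame (gam gx gy) e M ->
  Rabs (width gx gy al - width gx gy be) <= 4 * M * Rabs (al - be).
Proof.
intros HF; destruct (sf_onto _ _ _ HF al) as [t Ht].
destruct (frame_opposite _ _ _ t HF) as [o Ho].
destruct (sf_onto _ _ _ HF be) as [t' Ht'].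
destruct (frame_opposite _ _ _ t' HF) as [o' Ho'].
rewrite (width_opp gx gy e M al t o), (width_opp gx gy e M be t' o') by assumption.
apply Rle_trans with (4 * M * pdist (e t) (e t')); [now apply opp_width_lip|].
apply Rmult_le_compat_l; [assert (H := sf_pos _ _ _ HF); lra|].
rewrite Ht, Ht'; apply pdist_dir_le.
Qed.

(** * First-order expansion of the flow *)

Lemma flow1_expansion gx gy e M O x p :
  support_frame (gam gx gy) e M -> flow1 gx gy O x p ->
  exists r al, 0 < r /\ x = padd O (pscal r (dir al)) /\ pdist p O = r /\
    pdist p (psub x (pscal (2 * width gx gy al) (rot90 (dir al)))) <= 64 * (M * M) / r.
Proof.
intros HF (r & al & a & Hr & Ex & Ha0 & Hode & Ep).
fold (dir al) in Ex; fold (dir (a 1)) in Ep.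
assert (HM := sf_pos _ _ _ HF).
exists r, al; repeat split; try assumption.
  replace (pdist p O) with (pnorm (pscal r (dir (a 1)))).
    rewrite pnorm_scal, (pnorm_unit _ (pdot_dir _)), Rabs_pos_eq; lra.
  rewrite Ep; unfold pdist; f_equal; apply pair_ext; unfold_pt; ring.
assert (Hmvt : forall s, 0 <= s <= 1 ->
   exists c, 0 <= c <= s /\ a s - a 0 = - (2 * width gx gy (a c)) / r * s).
  intros s Hs.
  destruct (MVT_gen a 0 s (fun c => - (2 * width gx gy (a c)) / r)) as (c & Hc & Hce).
  - intros y _; apply Hode.
  - intros y _; apply derivable_continuous_pt.
    exists (- (2 * width gx gy (a y)) / r); apply is_derive_Reals, Hode.
  - exists c; rewrite Rmin_left, Rmax_right in Hc by lra; split; [exact Hc|].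
    rewrite Hce; ring.
assert (Hvel : forall s c, 0 <= s <= 1 -> Rabs (- (2 * width gx gy (a c)) / r * s) <= 4 * M / r).
  intros s c Hs.
  replace (- (2 * width gx gy (a c)) / r * s) with (width gx gy (a c) * (- 2 * s / r)) by (field; lra).
  rewrite Rabs_mult.
  replace (4 * M / r) with (2 * M * (2 / r)) by (field; lra).
  apply Rmult_le_compat; try apply Rabs_pos; [now apply (width_bound _ _ e)|].
  replace (-2 * s / r) with (- (2 / r * s)) by (field; lra); rewrite Rabs_Ropp.
  assert (0 < 2 / r) by (apply Rdiv_lt_0_compat; lra).
  rewrite Rabs_pos_eq; nra.
destruct (Hmvt 1 ltac:(lra)) as (c & Hc & Hce).
set (h := a 1 - a 0) in *.
assert (Hh : Rabs h <= 4 * M / r) by (rewrite Hce; apply Hvel; lra).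
assert (Hca : Rabs (a c - al) <= 4 * M / r).
  destruct (Hmvt c ltac:(lra)) as (c' & Hc' & Hce').
  rewrite <- Ha0, Hce'; apply Hvel; lra.
(* The displacement is given exactly by the width at an intermediate angle [a c]; this angle is
   within [4 M / r] of [al], and [width_lip] transfers the width back. *)
assert (Hrh : Rabs (r * h + 2 * width gx gy al) <= 32 * (M * M) / r).
  replace (r * h + 2 * width gx gy al) with (-2 * (width gx gy (a c) - width gx gy al))
    by (rewrite Hce; field; lra).
  rewrite Rabs_mult, (Rabs_left (-2)) by lra.
  assert (Hl := width_lip gx gy e M (a c) al HF).
  replace (32 * (M * M) / r) with (2 * (4 * M * (4 * M / r))) by (field; lra).
  assert (4 * M * Rabs (a c - al) <= 4 * M * (4 * M / r))
    by (apply Rmult_le_compat_l; lra).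
  lra.
assert (Hq : r * (2 * (h * h)) <= 32 * (M * M) / r).
  assert (Hhh : h * h <= 4 * M / r * (4 * M / r)).
    replace (h * h) with (Rabs h * Rabs h) by (rewrite <- Rabs_mult, Rabs_pos_eq; nra).
    apply Rmult_le_compat; try apply Rabs_pos; assumption.
  replace (32 * (M * M) / r) with (r * (2 * (4 * M / r * (4 * M / r)))) by (field; lra).
  apply Rmult_le_compat_l; lra.
assert (Ha1 : a 1 = al + h) by (unfold h; rewrite Ha0; ring).
unfold pdist.
replace (psub p (psub x (pscal (2 * width gx gy al) (rot90 (dir al))))) with
  (padd (pscal r (psub (psub (dir (al + h)) (dir al)) (pscal h (rot90 (dir al)))))
    (pscal (r * h + 2 * width gx gy al) (rot90 (dir al)))).
  apply Rle_trans with (1 := pnorm_add _ _).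
  rewrite !pnorm_scal, pnorm_rot90, (pnorm_unit _ (pdot_dir al)), (Rabs_pos_eq r) by lra.
  assert (Ht := dir_taylor al h).
  apply (Rmult_le_compat_l r) in Ht; [|lra].
  replace (64 * (M * M) / r) with (32 * (M * M) / r + 32 * (M * M) / r) by (field; lra).
  lra.
rewrite Ep, Ex, Ha1; apply pair_ext; unfold_pt; ring.
Qed.

(** * The estimate for a framed curve *)

Lemma framed_oval_estimate gx gy q e M O :
  support_frame (gam gx gy) e M ->
  (forall t, 0 < q t /\ tang gx gy t = pscal (q t) (e t)) ->
  exists C, forall x y z p,
    olb_map gx gy x y -> olb_map gx gy y z -> flow1 gx gy O x p ->
    pdist z p <= C / pdist x O.
Proof.
intros HF HT; assert (HM := sf_pos _ _ _ HF).
set (H := 2 * M + pdist (gam gx gy 0) O).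
assert (HH : forall t, pdist (gam gx gy t) O <= H).
  intros t; apply Rle_trans with (1 := pdist_triangle _ (gam gx gy 0) _).
  apply Rplus_le_compat_r; now apply (frame_diam _ _ _ t 0 HF).
assert (H0 : 0 < H) by (unfold H; assert (P := pnorm_ge0 (psub (gam gx gy 0) O)); unfold pdist; lra).
clearbody H.
(* Beyond [R0], [a >= r - H] exceeds both [r / 2] and the threshold [100 M]. Within [R0], [Q] bounds
   the distance from [z] to [p] by way of [g t] and [O]. *)
set (R0 := 2 * H + 200 * M); set (Q := 5 * R0 + 5 * H + 42 * M).
exists (384 * (M * M) + 24 * (M * H) + Q * R0).
intros x y z p Hxy Hyz Hflow.
destruct (flow1_expansion _ _ _ _ _ _ _ HF Hflow) as (r & al & Hr & Ex & Hpr & Hp).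
destruct (olb_two_steps _ _ _ _ _ _ _ _ HF HT Hxy Hyz) as (t & a & Ha & EA & Hcr & Has).
set (g := gam gx gy) in *.
assert (Hxr : pdist x O = r).
  replace (pdist x O) with (pnorm (pscal r (dir al))).
    rewrite pnorm_scal, (pnorm_unit _ (pdot_dir _)), Rabs_pos_eq; lra.
  rewrite Ex; unfold pdist; f_equal; apply pair_ext; unfold_pt; ring.
rewrite Hxr.
assert (He := sf_unit _ _ _ HF t).
destruct (nearly_opposite (dir al) (e t) a r H) as [Hra Heps];
  [apply pdot_dir | assumption | lra | lra | |].
  replace (padd (pscal r (dir al)) (pscal a (e t))) with (psub (g t) O); [apply HH|].
  transitivity (padd (psub (padd O (pscal r (dir al))) O)
     (psub (g t) (psub (g t) (pscal a (e t))))).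
    - rewrite <- Ex, <- EA; apply pair_ext; unfold_pt; ring.
    - apply pair_ext; unfold_pt; ring.
apply Rabs_le_between in Hra.
assert (HMM : 0 < M * M) by nra; assert (HMH : 0 < M * H) by nra.
destruct (Rle_or_lt r R0) as [Hsmall|Hbig].
- assert (HQ : pdist z p <= Q).
    apply Rle_trans with (1 := pdist_triangle _ (g t) _).
    assert (T1 := pdist_triangle (g t) O p); rewrite (pdist_sym O p) in T1.
    assert (T2 := HH t); unfold Q; lra.
  apply Rle_trans with (1 := HQ).
  assert (0 < Q) by (unfold Q, R0; lra).
  apply Rmult_le_reg_r with r; [assumption|].
  unfold Rdiv; rewrite Rmult_assoc, Rinv_l by lra; nra.
- assert (Ha2 : r / 2 <= a) by (unfold R0 in Hbig; lra).
  destruct (frame_opposite _ _ _ t HF) as [o Ho].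
  assert (Hz := Has ltac:(unfold R0 in Hbig; lra) o Ho).
  assert (HW := opp_width_bound _ _ _ t o HF).
  set (eps := pnorm (padd (dir al) (e t))) in *.
  assert (Heps1 : eps <= 2 * H / r).
    apply Rmult_le_reg_l with r; [assumption|].
    replace (r * (2 * H / r)) with (2 * H) by (field; lra); lra.
  (* Since [e t] is nearly [- dir al], the direction [al] is compared with [e o]. *)
  assert (HwW : Rabs (width gx gy al - opp_width g e t o) <= 4 * M * eps).
    destruct (sf_onto _ _ _ HF al) as [tau Htau].
    destruct (frame_opposite _ _ _ tau HF) as [o' Ho'].
    rewrite (width_opp gx gy e M al tau o') by assumption.
    rewrite <- (opp_width_sym g e t o Ho).
    replace eps with (pdist (e tau) (e o)).
      apply opp_width_lip; try assumption.
      rewrite Ho; apply pair_ext; unfold_pt; ring.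
    rewrite Ho, Htau; unfold eps, pdist; f_equal; apply pair_ext; unfold_pt; ring.
  set (W := opp_width g e t o) in *; set (w := width gx gy al) in *.
  (* The step [2 W rot90 (e t)] becomes [- 2 w rot90 (dir al)]: this reversal produces the minus
     sign in the vector field. *)
  assert (Hmid : pdist (padd x (pscal (2 * W) (rot90 (e t))))
      (psub x (pscal (2 * w) (rot90 (dir al)))) <= 24 * (M * H) / r).
    unfold pdist.
    replace (psub _ _) with (padd (pscal (2 * W) (rot90 (padd (dir al) (e t))))
       (pscal (2 * (w - W)) (rot90 (dir al)))) by (apply pair_ext; unfold_pt; ring).
    apply Rle_trans with (1 := pnorm_add _ _).
    rewrite !pnorm_scal, !pnorm_rot90, (pnorm_unit _ (pdot_dir al)), !Rabs_mult,
      (Rabs_pos_eq 2) by lra.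
    fold eps.
    assert (Heps0 : 0 <= eps) by apply pnorm_ge0.
    assert (B1 : Rabs W * eps <= 2 * M * eps) by (apply Rmult_le_compat_r; assumption).
    assert (B2 : M * eps <= M * (2 * H / r)) by (apply Rmult_le_compat_l; lra).
    replace (24 * (M * H) / r) with (12 * (M * (2 * H / r))) by (field; lra).
    lra.
  assert (Hz2 : 160 * (M * M) / a <= 320 * (M * M) / r).
    apply Rmult_le_reg_r with (a * r); [nra|].
    replace (160 * (M * M) / a * (a * r)) with (160 * (M * M) * r) by (field; lra).
    replace (320 * (M * M) / r * (a * r)) with (320 * (M * M) * a) by (field; lra).
    nra.
  apply Rle_trans with (1 := pdist_triangle _ (padd x (pscal (2 * W) (rot90 (e t)))) _).
  assert (T1 := pdist_triangle (padd x (pscal (2 * W) (rot90 (e t))))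
    (psub x (pscal (2 * w) (rot90 (dir al)))) p).
  rewrite (pdist_sym (psub x (pscal (2 * w) (rot90 (dir al)))) p) in T1.
  replace ((384 * (M * M) + 24 * (M * H) + Q * R0) / r) with
    (320 * (M * M) / r + 24 * (M * H) / r + 64 * (M * M) / r + Q * R0 / r) by (field; lra).
  assert (0 < Q * R0 / r).
    apply Rdiv_lt_0_compat; [|assumption].
    unfold Q, R0; apply Rmult_lt_0_compat; lra.
  lra.
Qed.

(** * The tangent angle of an oval *)

(** An interior point is needed for strict convexity: the sine of the turning angle vanishes at the
    contact point and after a turn by [PI]. *)
Lemma mean_value_open (f df : R -> R) a b :
  (forall x, is_derive f x (df x)) -> a < b ->
  exists c, a < c < b /\ f b - f a = df c * (b - a).
Proof.
intros Hf Hab.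
destruct (MVT_cor2 f df a b Hab) as (c & Hc & Hcb); [intros c _; apply is_derive_Reals, Hf|].
now exists c.
Qed.

Lemma derive_zero_constant f a b : (forall x, is_derive f x 0) -> f a = f b.
Proof.
intros Hf; destruct (MVT_gen f a b (fun _ => 0)) as (c & _ & Hc).
- intros x _; apply Hf.
- intros x _; apply derivable_continuous_pt; exists 0; apply is_derive_Reals, Hf.
- lra.
Qed.

Lemma is_derive_continuity f df x : is_derive f x df -> continuity_pt f x.
Proof.
intros H; apply derivable_continuous_pt; exists df; now apply is_derive_Reals.
Qed.

Lemma increasing_of_derive (f df : R -> R) :
  (forall x, is_derive f x (df x)) -> (forall x, 0 < df x) ->
  forall a b, a < b -> f a < f b.
Proof.
intros Hf Hp a b Hab; destruct (mean_value_open f df a b Hf Hab) as (c & _ & Hc).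
assert (H := Hp c); nra.
Qed.

(** The angle is the integral of its expected derivative. In the frame rotated by [th], the
    coordinates [u], [v] of the normalised vector have derivative zero, and the initial angle makes
    them [1] and [0]. *)
Lemma angle_lift (x y dx dy : R -> R) :
  (forall t, is_derive x t (dx t)) -> (forall t, is_derive y t (dy t)) ->
  (forall t, continuous dx t) -> (forall t, continuous dy t) ->
  (forall t, 0 < x t * x t + y t * y t) ->
  exists th, forall t,
    is_derive th t ((x t * dy t - y t * dx t) / (x t * x t + y t * y t)) /\
    x t = sqrt (x t * x t + y t * y t) * cos (th t) /\
    y t = sqrt (x t * x t + y t * y t) * sin (th t).
Proof.
intros Hx Hy Cdx Cdy HN.
set (kap := fun t => (x t * dy t - y t * dx t) / (x t * x t + y t * y t)).
set (n := fun t => sqrt (x t * x t + y t * y t)).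
assert (Hn : forall t, 0 < n t) by (intros t; apply sqrt_lt_R0, HN).
assert (Hnn : forall t, n t * n t = x t * x t + y t * y t)
  by (intros t; apply sqrt_sqrt; assert (H := HN t); lra).
assert (Cx : forall t, continuous x t)
  by (intros t; apply (ex_derive_continuous x); eexists; apply Hx).
assert (Cy : forall t, continuous y t)
  by (intros t; apply (ex_derive_continuous y); eexists; apply Hy).
assert (Ck : forall t, continuous kap t).
  intros t; apply (continuous_mult (fun t => x t * dy t - y t * dx t)
     (fun t => / (x t * x t + y t * y t))).
  - apply (continuous_minus (fun t => x t * dy t) (fun t => y t * dx t));
      [apply (continuous_mult x dy)|apply (continuous_mult y dx)]; auto.
  - apply continuous_comp with (g := Rinv).
    + apply (continuous_plus (fun t => x t * x t) (fun t => y t * y t));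
        [apply (continuous_mult x x)|apply (continuous_mult y y)]; auto.
    + apply continuous_Rinv; assert (H := HN t); lra.
destruct (unit_vector_dir (x 0 / n 0) (y 0 / n 0)) as (th0 & Hc0 & Hs0).
  assert (P := Hn 0); replace (x 0 / n 0 * (x 0 / n 0) + y 0 / n 0 * (y 0 / n 0))
   with ((x 0 * x 0 + y 0 * y 0) / (n 0 * n 0)) by (field; lra).
  rewrite Hnn; field; assert (H := HN 0); lra.
set (th := fun t => th0 + RInt kap 0 t).
assert (Dth : forall t, is_derive th t (kap t)).
  intros t; unfold th.
  rewrite <- (Rplus_0_l (kap t)).
  apply (is_derive_plus (fun _ => th0) (RInt kap 0) t 0 (kap t));
    [apply (@is_derive_const R_AbsRing R_NormedModule)|].
  apply (is_derive_RInt kap _ 0); [|apply Ck].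
  apply filter_forall; intros z; apply (@RInt_correct R_CompleteNormedModule).
  apply (@ex_RInt_continuous R_CompleteNormedModule); intros w _; apply Ck.
set (nu := fun t => (x t * dx t + y t * dy t) / n t).
assert (Dn : forall t, is_derive n t (nu t)).
  intros t; assert (P := Hn t); apply is_derive_Reals.
  replace (nu t) with (/ (2 * n t) * ((dx t * x t + x t * dx t) + (dy t * y t + y t * dy t)))
    by (unfold nu; field; lra).
  apply (derivable_pt_lim_comp (fun t => x t * x t + y t * y t) sqrt);
    [|now apply derivable_pt_lim_sqrt].
  apply derivable_pt_lim_plus; apply derivable_pt_lim_mult; apply is_derive_Reals; auto.
assert (Hnu : forall t, n t * nu t = x t * dx t + y t * dy t)
  by (intros t; unfold nu; field; assert (P := Hn t); lra).
assert (Hka : forall t, kap t * (x t * x t + y t * y t) = x t * dy t - y t * dx t)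
  by (intros t; unfold kap; field; assert (P := HN t); lra).
set (u := fun t => (x t * cos (th t) + y t * sin (th t)) / n t).
set (v := fun t => (y t * cos (th t) - x t * sin (th t)) / n t).
assert (Dcos : forall t, derivable_pt_lim (fun t => cos (th t)) t (- sin (th t) * kap t)).
  intros t; apply (derivable_pt_lim_comp th cos);
    [apply is_derive_Reals, Dth|apply derivable_pt_lim_cos].
assert (Dsin : forall t, derivable_pt_lim (fun t => sin (th t)) t (cos (th t) * kap t)).
  intros t; apply (derivable_pt_lim_comp th sin);
    [apply is_derive_Reals, Dth|apply derivable_pt_lim_sin].
assert (Du : forall t, is_derive u t 0).
  intros t; assert (P := Hn t); apply is_derive_Reals.
  set (c := cos (th t)); set (s := sin (th t)).
  replace 0 with ((((dx t * c + x t * (- s * kap t)) + (dy t * s + y t * (c * kap t))) * n t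
    - nu t * (x t * c + y t * s)) / Rsqr (n t)).
    apply (derivable_pt_lim_div (fun t => x t * cos (th t) + y t * sin (th t)) n);
      [|apply is_derive_Reals, Dn|lra].
    apply derivable_pt_lim_plus; apply derivable_pt_lim_mult; auto;
      apply is_derive_Reals; auto.
  transitivity (((dx t * c + dy t * s) * (n t * n t) + kap t * (n t * n t) * (y t * c - x t * s)
      - (x t * c + y t * s) * (n t * nu t)) / (n t * n t * n t)); [unfold Rsqr; field; lra|].
  rewrite Hnu, !Hnn, Hka; unfold Rdiv; rewrite Rmult_eq_0_compat_r; [reflexivity|ring].
assert (Dv : forall t, is_derive v t 0).
  intros t; assert (P := Hn t); apply is_derive_Reals.
  set (c := cos (th t)); set (s := sin (th t)).
  replace 0 with ((((dy t * c + y t * (- s * kap t)) - (dx t * s + x t * (c * kap t))) * n t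
    - nu t * (y t * c - x t * s)) / Rsqr (n t)).
    apply (derivable_pt_lim_div (fun t => y t * cos (th t) - x t * sin (th t)) n);
      [|apply is_derive_Reals, Dn|lra].
    apply derivable_pt_lim_minus; apply derivable_pt_lim_mult; auto;
      apply is_derive_Reals; auto.
  transitivity (((dy t * c - dx t * s) * (n t * n t) - kap t * (n t * n t) * (x t * c + y t * s)
      - (y t * c - x t * s) * (n t * nu t)) / (n t * n t * n t)); [unfold Rsqr; field; lra|].
  rewrite Hnu, !Hnn, Hka; unfold Rdiv; rewrite Rmult_eq_0_compat_r; [reflexivity|ring].
assert (Hth0 : th 0 = th0) by (unfold th; rewrite RInt_point; apply Rplus_0_r).
assert (P0 := Hn 0).
assert (Hx0 : x 0 = n 0 * cos th0) by (rewrite <- Hc0; field; lra).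
assert (Hy0 : y 0 = n 0 * sin th0) by (rewrite <- Hs0; field; lra).
exists th; intros t; split; [apply Dth|].
assert (Hu : u t = 1).
  rewrite (derive_zero_constant u t 0 Du); unfold u; rewrite Hth0, Hx0, Hy0.
  transitivity ((sin th0)² + (cos th0)²); [unfold Rsqr; field; lra|apply sin2_cos2].
assert (Hv : v t = 0).
  rewrite (derive_zero_constant v t 0 Dv); unfold v; rewrite Hth0, Hx0, Hy0; field; lra.
assert (P := Hn t); fold (n t).
assert (Hu' : x t * cos (th t) + y t * sin (th t) = n t)
  by (transitivity (u t * n t); [unfold u; field; lra|rewrite Hu; ring]).
assert (Hv' : y t * cos (th t) - x t * sin (th t) = 0)
  by (transitivity (v t * n t); [unfold v; field; lra|rewrite Hv; ring]).
assert (H1 := sin2_cos2 (th t)); unfold Rsqr in H1.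
split.
- transitivity ((x t * cos (th t) + y t * sin (th t)) * cos (th t)
    - (y t * cos (th t) - x t * sin (th t)) * sin (th t)).
    transitivity (x t * (sin (th t) * sin (th t) + cos (th t) * cos (th t))); [rewrite H1|]; ring.
  rewrite Hu', Hv'; ring.
- transitivity ((x t * cos (th t) + y t * sin (th t)) * sin (th t)
    + (y t * cos (th t) - x t * sin (th t)) * cos (th t)).
    transitivity (y t * (sin (th t) * sin (th t) + cos (th t) * cos (th t))); [rewrite H1|]; ring.
  rewrite Hu', Hv'; ring.
Qed.

(** * Periodicity and winding numbers *)

Lemma Derive_n_periodic f L n :
  (forall t, f (t + L) = f t) -> forall t, Derive_n f n (t + L) = Derive_n f n t.
Proof.
intros H t; rewrite <- Derive_n_comp_trans; apply Derive_n_ext, H.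
Qed.

Lemma same_dir_mod_2PI a b :
  cos a = cos b -> sin a = sin b -> exists k : Z, a = b + 2 * PI * IZR k.
Proof.
intros Hc Hs.
assert (H : cos (a - b) = 1).
  rewrite cos_minus, Hc, Hs; assert (E := sin2_cos2 b); unfold Rsqr in E; lra.
assert (H2 := one_minus_cos (a - b)); rewrite H in H2.
destruct (sin_eq_0_0 ((a - b) / 2)) as [k Hk]; [nra|].
exists k; lra.
Qed.

Lemma angle_period (th kap : R -> R) L :
  (forall t, is_derive th t (kap t)) -> (forall t, kap (t + L) = kap t) ->
  cos (th L) = cos (th 0) -> sin (th L) = sin (th 0) ->
  exists k : Z, forall t, th (t + L) = th t + 2 * PI * IZR k.
Proof.
intros Hd Hp Hc Hs; destruct (same_dir_mod_2PI _ _ Hc Hs) as [k Hk]; exists k; intros t.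
assert (D : forall s, is_derive (fun s => th (s + L) - th s) s 0).
  intros s; apply is_derive_Reals.
  replace 0 with (kap (s + L) * (1 + 0) - kap s) by (rewrite Hp; ring).
  apply (derivable_pt_lim_minus (fun s => th (s + L)) th); [|apply is_derive_Reals, Hd].
  apply (derivable_pt_lim_comp (fun s => s + L) th); [|apply is_derive_Reals, Hd].
  apply derivable_pt_lim_plus; [apply derivable_pt_lim_id|apply derivable_pt_lim_const].
assert (H := derive_zero_constant _ t 0 D); cbv beta in H; rewrite Rplus_0_l in H; lra.
Qed.

Lemma shift_into_period P x : 0 < P -> exists n : Z, 0 <= x + IZR n * P < P.
Proof.
intros HP; destruct (archimed (x / P)) as [H1 H2].
(* [up] is one more than the floor. *)
exists (1 - up (x / P))%Z; rewrite minus_IZR.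
set (z := IZR (up (x / P))) in *.
assert (E : x / P * P = x) by (field; lra).
split; nra.
Qed.

Lemma shift_iter f L c :
  (forall t, f (t + L) = f t + c) ->
  forall (n : Z) t, f (t + IZR n * L) = f t + IZR n * c.
Proof.
intros H.
assert (Hnat : forall (n : nat) t, f (t + INR n * L) = f t + INR n * c).
  induction n as [|n IH]; intros t.
  - cbn [INR]; rewrite !Rmult_0_l, !Rplus_0_r; reflexivity.
  - rewrite S_INR; replace (t + (INR n + 1) * L) with (t + INR n * L + L) by ring.
    rewrite H, IH; ring.
intros n t; destruct (Z.le_ge_cases 0 n) as [Hn|Hn].
- rewrite <- (Z2Nat.id n Hn), <- INR_IZR_INZ; apply Hnat.
- assert (E : IZR n = - INR (Z.to_nat (- n))).
    rewrite INR_IZR_INZ, Z2Nat.id by lia; rewrite opp_IZR; ring.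
  rewrite E; set (m := Z.to_nat (- n)).
  assert (Hm := Hnat m (t + - INR m * L)).
  replace (t + - INR m * L + INR m * L) with t in Hm by ring; lra.
Qed.

Lemma periodic_iter {T} (f : R -> T) L :
  (forall t, f (t + L) = f t) -> forall (n : Z) t, f (t + IZR n * L) = f t.
Proof.
intros H.
assert (Hnat : forall (n : nat) t, f (t + INR n * L) = f t).
  induction n as [|n IH]; intros t.
  - cbn [INR]; rewrite Rmult_0_l, Rplus_0_r; reflexivity.
  - rewrite S_INR; replace (t + (INR n + 1) * L) with (t + INR n * L + L) by ring.
    now rewrite H, IH.
intros n t; destruct (Z.le_ge_cases 0 n) as [Hn|Hn].
- rewrite <- (Z2Nat.id n Hn), <- INR_IZR_INZ; apply Hnat.
- assert (E : IZR n = - INR (Z.to_nat (- n))).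
    rewrite INR_IZR_INZ, Z2Nat.id by lia; rewrite opp_IZR; ring.
  rewrite E; set (m := Z.to_nat (- n)).
  rewrite <- (Hnat m (t + - INR m * L)); f_equal; ring.
Qed.

Lemma periodic_max f L :
  0 < L -> (forall t, f (t + L) = f t) -> (forall t, continuity_pt f t) ->
  exists m, forall t, f t <= f m.
Proof.
intros HL Hp Hc.
destruct (continuity_ab_maj f 0 L) as (m & Hm & _); [lra|intros; apply Hc|].
exists m; intros t; destruct (shift_into_period L t HL) as [n Hn].
rewrite <- (periodic_iter f L Hp n t); apply Hm; lra.
Qed.

Lemma onto_of_shift th L c :
  0 < c -> (forall t, th (t + L) = th t + c) -> continuity th ->
  forall y, exists t, th t = y.
Proof.
intros HP Hs Hc y.
destruct (shift_into_period c (th 0 - y) HP) as [n Hn].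
assert (E1 := shift_iter th L c Hs n 0).
assert (E2 := Hs (0 + IZR n * L)).
destruct (IVT_gen th (0 + IZR n * L - L) (0 + IZR n * L) y) as (t & _ & Ht); [exact Hc| |now exists t].
assert (E3 := Hs (0 + IZR n * L - L)).
replace (0 + IZR n * L - L + L) with (0 + IZR n * L) in E3 by ring.
rewrite Rmin_left, Rmax_right; lra.
Qed.

(* If the angle turned more than once per period, the radius at angles [a] and
   [a + 2 PI] would agree for some [a], as seen by comparing
   its maximum and its minimum. *)
Lemma simple_winding_once (phi rad : R -> R) L (k : Z) :
  0 < L -> (forall a b, a < b -> phi a < phi b) -> continuity phi ->
  (forall t, phi (t + L) = phi t + 2 * PI * IZR k) ->
  continuity rad -> (forall t, rad (t + L) = rad t) ->
  (forall s t, rad s = rad t -> phi s = phi t + 2 * PI -> ~ t < s < t + L) ->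
  k = 1%Z.
Proof.
intros HL Hinc Hcont Hper Crad Prad Hsimple.
assert (HPI := PI_RGT_0).
assert (Hk : (1 <= k)%Z).
  assert (H := Hinc 0 (0 + L) ltac:(lra)); rewrite Hper in H.
  assert (0 < IZR k) by nra; assert (0 < k)%Z by now apply lt_IZR.
  lia.
destruct (Z.eq_dec k 1) as [E|E]; [exact E|exfalso].
assert (Hk2 : 2 <= IZR k) by (apply IZR_le; lia).
assert (Hturn : 0 < 2 * PI * IZR k) by nra.
assert (Honto := onto_of_shift phi L _ Hturn Hper Hcont).
(* [psi] inverts the polar angle, so the radius becomes a function of the angle and a
   self-intersection at angles [2 PI] apart becomes a zero of [G]. *)
set (psi := fun y => proj1_sig (constructive_indefinite_description _ (Honto y))).
assert (Hpsi : forall y, phi (psi y) = y)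
  by (intros y; unfold psi; destruct constructive_indefinite_description; assumption).
assert (Hinj : forall a b, phi a <= phi b -> a <= b).
  intros a b Hab; destruct (Rle_or_lt a b) as [H|H]; [exact H|].
  apply Hinc in H; lra.
assert (Hpsi2 : forall t, psi (phi t) = t)
  by (intros t; apply Rle_antisym; apply Hinj; rewrite Hpsi; lra).
assert (Cpsi : continuity psi).
  intros y eps Heps.
  set (t := psi y).
  assert (H1 := Hinc (t - eps) t ltac:(lra)); assert (H2 := Hinc t (t + eps) ltac:(lra)).
  unfold t in H1, H2; rewrite Hpsi in H1, H2; fold t in H1, H2.
  exists (Rmin (y - phi (t - eps)) (phi (t + eps) - y)); split.
    apply Rmin_pos; lra.
  intros z [_ Hz]; unfold dist in *; simpl in *; unfold R_dist in *.
  assert (Hz1 := Rlt_le_trans _ _ _ Hz (Rmin_l _ _)).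
  assert (Hz2 := Rlt_le_trans _ _ _ Hz (Rmin_r _ _)).
  apply Rabs_def2 in Hz1; apply Rabs_def2 in Hz2; fold t.
  assert (B1 : t - eps < psi z).
    destruct (Rlt_or_le (t - eps) (psi z)) as [H|H]; [exact H|].
    destruct H as [H|H]; [apply Hinc in H|rewrite <- H in *]; rewrite Hpsi in *; lra.
  assert (B2 : psi z < t + eps).
    destruct (Rlt_or_le (psi z) (t + eps)) as [H|H]; [exact H|].
    destruct H as [H|H]; [apply Hinc in H|rewrite H in *]; rewrite Hpsi in *; lra.
  apply Rabs_def1; lra.
set (G := fun y => rad (psi (y + 2 * PI)) - rad (psi y)).
assert (CG : continuity G).
  apply continuity_minus; [|now apply continuity_comp].
  apply (continuity_comp (fun y => psi (y + 2 * PI)) rad); [|assumption].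
  apply (continuity_comp (fun y => y + 2 * PI) psi); [|assumption].
  apply continuity_plus; [apply derivable_continuous, derivable_id|].
  apply continuity_const; intros ? ?; reflexivity.
destruct (periodic_max rad L HL Prad Crad) as [tM HM].
destruct (periodic_max (fun t => - rad t) L HL) as [tm Hm].
  now intros t; rewrite Prad.
  now apply continuity_opp.
destruct (IVT_gen G (phi tM) (phi tm) 0 CG) as (y & _ & Hy).
  assert (G1 : G (phi tM) <= 0) by (unfold G; rewrite Hpsi2; assert (H := HM (psi (phi tM + 2 * PI))); lra).
  assert (G2 : 0 <= G (phi tm)) by (unfold G; rewrite Hpsi2; assert (H := Hm (psi (phi tm + 2 * PI))); lra).
  rewrite Rmin_left, Rmax_right; lra.
unfold G in Hy.
(* As [k >= 2], an increase of [2 PI] in the polar angle takes less than one period. *)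
apply (Hsimple (psi (y + 2 * PI)) (psi y)); [lra|rewrite !Hpsi; ring|].
split.
- apply Rnot_le_lt; intros H; destruct H as [H|H].
  + apply Hinc in H; rewrite !Hpsi in H; lra.
  + apply (f_equal phi) in H; rewrite !Hpsi in H; lra.
- apply Rnot_le_lt; intros H; destruct H as [H|H].
  + apply Hinc in H; rewrite Hper, !Hpsi in H; nra.
  + apply (f_equal phi) in H; rewrite Hper, !Hpsi in H; nra.
Qed.

(** If [k] and [l] differed, [th - phi] would change by at least [2 PI] over a period and pass
    through its initial value shifted by [PI], where the sine changes sign. *)
Lemma same_winding (th phi : R -> R) L (k l : Z) :
  continuity th -> continuity phi ->
  (forall t, th (t + L) = th t + 2 * PI * IZR k) ->
  (forall t, phi (t + L) = phi t + 2 * PI * IZR l) ->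
  (forall t, 0 < sin (th t - phi t)) -> k = l.
Proof.
intros Ct Cp Ht Hp Hs; assert (HPI := PI_RGT_0).
assert (Cd : continuity (fun t => th t - phi t)) by now apply continuity_minus.
destruct (Z.eq_dec k l) as [E|E]; [exact E|exfalso].
assert (E1 := Ht 0); assert (E2 := Hp 0); rewrite Rplus_0_l in E1, E2.
assert (P0 := Hs 0).
set (d0 := th 0 - phi 0) in *.
assert (Hn : 1 <= IZR (k - l) \/ IZR (k - l) <= -1).
  destruct (Z.le_gt_cases (k - l) 0); [right|left]; apply IZR_le; lia.
rewrite minus_IZR in Hn.
destruct Hn as [Hn|Hn].
- destruct (IVT_gen _ 0 L (d0 + PI) Cd) as (t & _ & Hst).
    fold d0; rewrite Rmin_left, Rmax_right; unfold d0; nra.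
  assert (H := Hs t); rewrite Hst, neg_sin in H; lra.
- destruct (IVT_gen _ 0 L (d0 - PI) Cd) as (t & _ & Hst).
    fold d0; rewrite Rmin_right, Rmax_left; unfold d0; nra.
  assert (H := Hs t); rewrite Hst, sin_minus, cos_PI, sin_PI in H; lra.
Qed.

Lemma dir_shift (n : Z) a : dir (a + IZR n * (2 * PI)) = dir a.
Proof.
apply periodic_iter; intros t; unfold dir.
now rewrite cos_plus, sin_plus, cos_2PI, sin_2PI, !Rmult_1_r, !Rmult_0_r,
  Rminus_0_r, Rplus_0_r.
Qed.

(** Because the tangent turns once, every point has a parameter whose tangent angle is within [PI]
    of that at [u]. There the height above the tangent at [u] has derivative [q sin (th t - th u)],
    whose sign is known. The factor [6] is [2] for the two coordinates times [3] from
    [chord_lower]. *)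
Lemma turning_frame gx gy q th kap M L :
  0 < M ->
  (forall t, gx (t + L) = gx t) -> (forall t, gy (t + L) = gy t) ->
  (forall t, is_derive gx t (q t * cos (th t))) ->
  (forall t, is_derive gy t (q t * sin (th t))) ->
  (forall t, is_derive th t (kap t)) ->
  (forall t, 0 < q t) -> (forall t, 0 < kap t) -> (forall t, q t <= M * kap t) ->
  (forall t, th (t + L) = th t + 2 * PI) ->
  support_frame (gam gx gy) (fun t => dir (th t)) (6 * M).
Proof.
intros HM Px Py Dx Dy Dth Hq Hk HqM Pth.
assert (HPI := PI_RGT_0).
assert (Hinc := increasing_of_derive th kap Dth Hk).
assert (Hwin : forall t u, exists t', - PI <= th t' - th u <= PI /\
    gam gx gy t' = gam gx gy t /\ dir (th t') = dir (th t)).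
  intros t u.
  destruct (shift_into_period (2 * PI) (th t - th u + PI) ltac:(lra)) as [n Hn].
  exists (t + IZR n * L).
  rewrite (shift_iter th L (2 * PI) Pth n t).
  split; [lra|split; [|apply dir_shift]].
  unfold gam; now rewrite (periodic_iter gx L Px), (periodic_iter gy L Py).
assert (Dv : forall u t, is_derive (fun t => pdet (dir (th u)) (psub (gam gx gy t) (gam gx gy u)))
    t (q t * sin (th t - th u))).
  intros u t; apply is_derive_Reals; unfold gam; unfold_pt.
  replace (q t * sin (th t - th u)) with
   ((0 * (gy t - gy u) + cos (th u) * (q t * sin (th t) - 0))
     - (0 * (gx t - gx u) + sin (th u) * (q t * cos (th t) - 0)))
   by (rewrite sin_minus; ring).
  apply (derivable_pt_lim_minus (fun t => cos (th u) * (gy t - gy u))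
    (fun t => sin (th u) * (gx t - gx u)));
  [ apply (derivable_pt_lim_mult (fun _ => cos (th u)) (fun t => gy t - gy u))
  | apply (derivable_pt_lim_mult (fun _ => sin (th u)) (fun t => gx t - gx u)) ];
  try apply derivable_pt_lim_const;
  [ apply (derivable_pt_lim_minus gy (fun _ => gy u))
  | apply (derivable_pt_lim_minus gx (fun _ => gx u)) ];
  try apply derivable_pt_lim_const; apply is_derive_Reals; auto.
(* Comparison with the circle of radius [M]: as [q <= M kap], the derivative has the opposite sign
   to that of the height, so the sum is largest at [u]. *)
assert (Dw : forall u t, is_derive
    (fun t => pdet (dir (th u)) (psub (gam gx gy t) (gam gx gy u)) + M * cos (th t - th u))
    t ((q t - M * kap t) * sin (th t - th u))).
  intros u t; apply is_derive_Reals.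
  replace ((q t - M * kap t) * sin (th t - th u)) with
    (q t * sin (th t - th u) + (0 * cos (th t - th u) + M * (- sin (th t - th u) * (kap t - 0))))
    by ring.
  apply (derivable_pt_lim_plus
    (fun t => pdet (dir (th u)) (psub (gam gx gy t) (gam gx gy u)))
    (fun t => M * cos (th t - th u))); [apply is_derive_Reals, Dv|].
  apply (derivable_pt_lim_mult (fun _ => M) (fun t => cos (th t - th u)));
    [apply derivable_pt_lim_const|].
  apply (derivable_pt_lim_comp (fun t => th t - th u) cos); [|apply derivable_pt_lim_cos].
  apply (derivable_pt_lim_minus th (fun _ => th u));
    [apply is_derive_Reals, Dth|apply derivable_pt_lim_const].
assert (V0 : forall u, pdet (dir (th u)) (psub (gam gx gy u) (gam gx gy u)) = 0)
  by (intros u; unfold_pt; ring).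
assert (Hconv : forall t u, - PI <= th t - th u <= PI ->
   (t = u \/ 0 < pdet (dir (th u)) (psub (gam gx gy t) (gam gx gy u))) /\
   pdet (dir (th u)) (psub (gam gx gy t) (gam gx gy u)) <= M * (1 - cos (th t - th u))).
  intros t u Htu; destruct (Rtotal_order t u) as [H|[H|H]].
  - assert (Hsin : forall c, t < c < u -> sin (th c - th u) < 0).
      intros c [Hc1 Hc2]; apply Hinc in Hc1; apply Hinc in Hc2.
      replace (th c - th u) with (- (th u - th c)) by ring; rewrite sin_neg.
      assert (0 < sin (th u - th c)) by (apply sin_gt_0; lra); lra.
    destruct (mean_value_open _ _ t u (Dv u) H) as (c & Hc & Ec).
    destruct (mean_value_open _ _ t u (Dw u) H) as (d & Hd & Ed).
    cbv beta in Ec, Ed; rewrite V0 in Ec, Ed.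
    rewrite Rminus_diag, cos_0 in Ed.
    assert (Sc := Hsin c Hc); assert (Sd := Hsin d Hd).
    assert (Qc := Hq c); assert (Qd := HqM d).
    split.
    + right; assert (0 < q c * - sin (th c - th u)) by (apply Rmult_lt_0_compat; lra); nra.
    + assert (0 <= (q d - M * kap d) * sin (th d - th u)) by nra; nra.
  - subst t; rewrite V0, Rminus_diag, cos_0; split; [now left|lra].
  - assert (Hsin : forall c, u < c < t -> 0 < sin (th c - th u)).
      intros c [Hc1 Hc2]; apply Hinc in Hc1; apply Hinc in Hc2; apply sin_gt_0; lra.
    destruct (mean_value_open _ _ u t (Dv u) H) as (c & Hc & Ec).
    destruct (mean_value_open _ _ u t (Dw u) H) as (d & Hd & Ed).
    cbv beta in Ec, Ed; rewrite V0 in Ec, Ed.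
    rewrite Rminus_diag, cos_0 in Ed.
    assert (Sc := Hsin c Hc); assert (Sd := Hsin d Hd).
    assert (Qc := Hq c); assert (Qd := HqM d).
    split.
    + right; assert (0 < q c * sin (th c - th u)) by (apply Rmult_lt_0_compat; lra); nra.
    + assert ((q d - M * kap d) * sin (th d - th u) <= 0) by nra; nra.
assert (Hlip : forall f a, (forall t, is_derive f t (q t * a t)) ->
    (forall t, -1 <= a t <= 1) -> forall t u, Rabs (f t - f u) <= M * Rabs (th t - th u)).
  intros f a Df Ha.
  assert (Hw : forall t u, u < t -> Rabs (f t - f u) <= M * (th t - th u)).
    intros t u Hut.
    destruct (mean_value_open (fun t => f t - M * th t) (fun t => q t * a t - M * kap t) u t)
      as (c & _ & Ec); [|exact Hut|].
      intros x; apply is_derive_Reals.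
      replace (q x * a x - M * kap x) with (q x * a x - (0 * th x + M * kap x)) by ring.
      apply (derivable_pt_lim_minus f (fun t => M * th t)); [apply is_derive_Reals, Df|].
      apply (derivable_pt_lim_mult (fun _ => M) th);
        [apply derivable_pt_lim_const|apply is_derive_Reals, Dth].
    destruct (mean_value_open (fun t => f t + M * th t) (fun t => q t * a t + M * kap t) u t)
      as (d & _ & Ed); [|exact Hut|].
      intros x; apply is_derive_Reals.
      replace (q x * a x + M * kap x) with (q x * a x + (0 * th x + M * kap x)) by ring.
      apply (derivable_pt_lim_plus f (fun t => M * th t)); [apply is_derive_Reals, Df|].
      apply (derivable_pt_lim_mult (fun _ => M) th);
        [apply derivable_pt_lim_const|apply is_derive_Reals, Dth].
    cbv beta in Ec, Ed.
    assert (A1 := Ha c); assert (A2 := Ha d); assert (Q1 := HqM c); assert (Q2 := HqM d).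
    assert (P1 := Hq c); assert (P2 := Hq d).
    assert (q c * a c - M * kap c <= 0) by nra.
    assert (0 <= q d * a d + M * kap d) by nra.
    apply Rabs_le; split; nra.
  intros t u; destruct (Rtotal_order t u) as [H|[H|H]].
  - rewrite Rabs_minus_sym, (Rabs_minus_sym (th t)).
    rewrite (Rabs_pos_eq (th u - th t)) by (apply Hinc in H; lra); now apply Hw.
  - subst; rewrite !Rminus_diag, Rabs_R0; lra.
  - rewrite (Rabs_pos_eq (th t - th u)) by (apply Hinc in H; lra); now apply Hw.
constructor.
- lra.
- intros t; apply pdot_dir.
- intros a; destruct (onto_of_shift th L (2 * PI) ltac:(lra) Pth) with (y := a) as [t Ht].
    intros t; apply (is_derive_continuity th (kap t)), Dth.
  exists t; now rewrite Ht.
- intros t u; destruct (Hwin t u) as (t' & Hw & Eg & _); rewrite <- Eg.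
  destruct (Hconv t' u Hw) as [[E|E] _]; [rewrite E, V0|]; lra.
- intros t u; destruct (Hwin t u) as (t' & Hw & Eg & Ed); rewrite <- Eg, <- Ed.
  destruct (Hconv t' u Hw) as [_ H].
  replace (pdot (dir (th u)) (dir (th t'))) with (cos (th t' - th u))
    by (rewrite cos_minus; unfold_pt; ring).
  assert (B := COS_bound (th t' - th u)); nra.
- intros t u; destruct (Hwin t u) as (t' & Hw & Eg & Ed); rewrite <- Eg, <- Ed.
  intros Hz; destruct (Hconv t' u Hw) as [[E|E] _]; [now rewrite E|lra].
- intros t u; destruct (Hwin t u) as (t' & Hw & Eg & Ed); rewrite <- Eg, <- Ed.
  assert (B1 := Hlip gx _ Dx (fun t => COS_bound (th t)) t' u).
  assert (B2 := Hlip gy _ Dy (fun t => SIN_bound (th t)) t' u).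
  assert (B3 := chord_lower _ _ Hw).
  apply Rle_trans with (Rabs (gx t' - gx u) + Rabs (gy t' - gy u)).
    replace (pdist (gam gx gy t') (gam gx gy u)) with
      (pnorm (padd (pscal (gx t' - gx u) (1, 0)) (pscal (gy t' - gy u) (0, 1))))
      by (unfold pdist; f_equal; unfold gam; apply pair_ext; unfold_pt; ring).
    apply Rle_trans with (1 := pnorm_add _ _); rewrite !pnorm_scal, !pnorm_unit;
      unfold_pt; lra.
  nra.
Qed.

Lemma oval_frame gx gy L O :
  is_oval gx gy L -> in_interior gx gy O ->
  exists q e M, support_frame (gam gx gy) e M /\
    forall t, 0 < q t /\ tang gx gy t = pscal (q t) (e t).
Proof.
intros (HL & Hper & Hsm & Hsimple & Hcurv) Hint.
assert (Px : forall t, gx (t + L) = gx t) by apply Hper.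
assert (Py : forall t, gy (t + L) = gy t) by apply Hper.
assert (Dx : forall t, is_derive gx t (Derive gx t))
  by (intros t; apply Derive_correct, (Hsm 1%nat t)).
assert (Dy : forall t, is_derive gy t (Derive gy t))
  by (intros t; apply Derive_correct, (Hsm 1%nat t)).
assert (Dx2 : forall t, is_derive (Derive gx) t (Derive_n gx 2 t))
  by (intros t; apply Derive_correct, (Hsm 2%nat t)).
assert (Dy2 : forall t, is_derive (Derive gy) t (Derive_n gy 2 t))
  by (intros t; apply Derive_correct, (Hsm 2%nat t)).
assert (Cx : forall t, continuous (Derive gx) t)
  by (intros t; apply (ex_derive_continuous (Derive gx)); eexists; apply Dx2).
assert (Cy : forall t, continuous (Derive gy) t)
  by (intros t; apply (ex_derive_continuous (Derive gy)); eexists; apply Dy2).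
assert (Cx2 : forall t, continuous (Derive_n gx 2) t)
  by (intros t; apply (ex_derive_continuous (Derive_n gx 2)), (Hsm 3%nat t)).
assert (Cy2 : forall t, continuous (Derive_n gy 2) t)
  by (intros t; apply (ex_derive_continuous (Derive_n gy 2)), (Hsm 3%nat t)).
assert (Px1 : forall t, Derive gx (t + L) = Derive gx t)
  by apply (Derive_n_periodic gx L 1 Px).
assert (Py1 : forall t, Derive gy (t + L) = Derive gy t)
  by apply (Derive_n_periodic gy L 1 Py).
assert (Px2 := Derive_n_periodic gx L 2 Px); assert (Py2 := Derive_n_periodic gy L 2 Py).
set (x1 := Derive gx) in *; set (y1 := Derive gy) in *.
set (x2 := Derive_n gx 2) in *; set (y2 := Derive_n gy 2) in *.
assert (Hdet : forall t, 0 < x1 t * y2 t - y1 t * x2 t) by exact Hcurv.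
assert (HO : forall t, 0 < (gx t - fst O) * y1 t - (gy t - snd O) * x1 t).
  intros t; assert (H := Hint t); unfold tang, gam in H; fold x1 y1 in H; unfold_pt; lra.
clear Hcurv Hint Hsm Hper; clearbody x1 y1 x2 y2.
assert (HN : forall t, 0 < x1 t * x1 t + y1 t * y1 t).
  intros t; assert (H := Hdet t).
  destruct (Req_dec (x1 t) 0) as [E|E]; [|nra].
  destruct (Req_dec (y1 t) 0) as [E'|E']; [rewrite E, E' in H; lra|nra].
set (cx := fun t => gx t - fst O); set (cy := fun t => gy t - snd O).
assert (HNc : forall t, 0 < cx t * cx t + cy t * cy t).
  intros t; assert (H := HO t); fold (cx t) (cy t) in H.
  destruct (Req_dec (cx t) 0) as [E|E]; [|nra].
  destruct (Req_dec (cy t) 0) as [E'|E']; [rewrite E, E' in H; lra|nra].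
assert (Dcx : forall t, is_derive cx t (x1 t)).
  intros t; apply is_derive_Reals; rewrite <- (Rminus_0_r (x1 t)).
  apply (derivable_pt_lim_minus gx (fun _ => fst O));
    [apply is_derive_Reals, Dx|apply derivable_pt_lim_const].
assert (Dcy : forall t, is_derive cy t (y1 t)).
  intros t; apply is_derive_Reals; rewrite <- (Rminus_0_r (y1 t)).
  apply (derivable_pt_lim_minus gy (fun _ => snd O));
    [apply is_derive_Reals, Dy|apply derivable_pt_lim_const].
destruct (angle_lift x1 y1 x2 y2) as [th Hth]; auto.
destruct (angle_lift cx cy x1 y1) as [phi Hphi]; auto.
set (N := fun t => x1 t * x1 t + y1 t * y1 t) in *.
set (Nc := fun t => cx t * cx t + cy t * cy t) in *.
set (kap := fun t => (x1 t * y2 t - y1 t * x2 t) / N t).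
set (kc := fun t => (cx t * y1 t - cy t * x1 t) / Nc t).
assert (Dth : forall t, is_derive th t (kap t)) by apply Hth.
assert (Dphi : forall t, is_derive phi t (kc t)) by apply Hphi.
assert (Hkap : forall t, 0 < kap t) by (intros t; apply Rdiv_lt_0_compat; [apply Hdet|apply HN]).
assert (Hkc : forall t, 0 < kc t) by (intros t; apply Rdiv_lt_0_compat; [apply HO|apply HNc]).
assert (Cth : continuity th) by (intros t; apply (is_derive_continuity _ (kap t)), Dth).
assert (Cphi : continuity phi) by (intros t; apply (is_derive_continuity _ (kc t)), Dphi).
assert (PN : forall t, N (t + L) = N t) by (intros t; unfold N; now rewrite Px1, Py1).
assert (Pcx : forall t, cx (t + L) = cx t) by (intros t; unfold cx; now rewrite Px).
assert (Pcy : forall t, cy (t + L) = cy t) by (intros t; unfold cy; now rewrite Py).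
assert (PNc : forall t, Nc (t + L) = Nc t) by (intros t; unfold Nc; now rewrite Pcx, Pcy).
assert (Ex1 : forall t, x1 t = sqrt (N t) * cos (th t)) by apply Hth.
assert (Ey1 : forall t, y1 t = sqrt (N t) * sin (th t)) by apply Hth.
assert (Ecx : forall t, cx t = sqrt (Nc t) * cos (phi t)) by apply Hphi.
assert (Ecy : forall t, cy t = sqrt (Nc t) * sin (phi t)) by apply Hphi.
assert (SN : forall t, 0 < sqrt (N t)) by (intros t; apply sqrt_lt_R0, HN).
assert (SNc : forall t, 0 < sqrt (Nc t)) by (intros t; apply sqrt_lt_R0, HNc).
destruct (angle_period th kap L Dth) as [k Hk].
  intros t; unfold kap; now rewrite PN, Px1, Py1, Px2, Py2.
  apply Rmult_eq_reg_l with (sqrt (N 0)); [|assert (P := SN 0); lra].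
  rewrite <- Ex1, <- Px1, <- (PN 0), Rplus_0_l; symmetry; apply Ex1.
  apply Rmult_eq_reg_l with (sqrt (N 0)); [|assert (P := SN 0); lra].
  rewrite <- Ey1, <- Py1, <- (PN 0), Rplus_0_l; symmetry; apply Ey1.
destruct (angle_period phi kc L Dphi) as [l Hl].
  intros t; unfold kc; now rewrite PNc, Px1, Py1, Pcx, Pcy.
  apply Rmult_eq_reg_l with (sqrt (Nc 0)); [|assert (P := SNc 0); lra].
  rewrite <- Ecx, <- Pcx, <- (PNc 0), Rplus_0_l; symmetry; apply Ecx.
  apply Rmult_eq_reg_l with (sqrt (Nc 0)); [|assert (P := SNc 0); lra].
  rewrite <- Ecy, <- Pcy, <- (PNc 0), Rplus_0_l; symmetry; apply Ecy.
(* The interior point is to the left of every tangent, so the angle from radius to tangent has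
   positive sine. *)
assert (Hsin : forall t, 0 < sin (th t - phi t)).
  intros t; assert (H := HO t); fold (cx t) (cy t) in H.
  rewrite Ex1, Ey1, Ecx, Ecy in H.
  replace (sqrt (Nc t) * cos (phi t) * (sqrt (N t) * sin (th t)) -
    sqrt (Nc t) * sin (phi t) * (sqrt (N t) * cos (th t)))
    with (sqrt (Nc t) * sqrt (N t) * sin (th t - phi t)) in H by (rewrite sin_minus; ring).
  assert (0 < sqrt (Nc t) * sqrt (N t)) by (apply Rmult_lt_0_compat; auto).
  nra.
assert (Hl1 : l = 1%Z).
  apply (simple_winding_once phi Nc L l HL); auto.
  - now apply (increasing_of_derive phi kc).
  - intros t; apply derivable_continuous_pt.
    exists ((x1 t * cx t + cx t * x1 t) + (y1 t * cy t + cy t * y1 t)).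
    apply derivable_pt_lim_plus; apply derivable_pt_lim_mult; apply is_derive_Reals; auto.
  - intros s t Hr Ha Hst.
    assert (Eg : gam gx gy s = gam gx gy t).
      assert (Ed : dir (phi s) = dir (phi t)).
        rewrite Ha, <- (dir_shift 1 (phi t)); f_equal; ring.
      assert (E1 : cx s = cx t).
        rewrite !Ecx, Hr; f_equal; exact (f_equal fst Ed).
      assert (E2 : cy s = cy t).
        rewrite !Ecy, Hr; f_equal; exact (f_equal snd Ed).
      unfold gam; unfold cx in E1; unfold cy in E2; apply pair_ext; cbn; lra.
    (* Injectivity is assumed on [[0, L)] only. After reduction, [s - t] would be an integer
       multiple of [L] strictly between [0] and [L]. *)
    destruct (shift_into_period L s HL) as [n Hn].
    destruct (shift_into_period L t HL) as [m Hm].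
    assert (Pg : forall (j : Z) v, gam gx gy (v + IZR j * L) = gam gx gy v).
      apply (periodic_iter (gam gx gy)); intros v; unfold gam; now rewrite Px, Py.
    assert (E := Hsimple _ _ Hn Hm ltac:(rewrite !Pg; exact Eg)).
    assert (Ez : s - t = IZR (m - n) * L) by (rewrite minus_IZR; lra).
    assert (Hz : 0 < IZR (m - n) < 1).
      split; apply Rmult_lt_reg_r with L; lra.
    destruct Hz as [Hz1 Hz2]; apply lt_IZR in Hz1; apply lt_IZR in Hz2; lia.
assert (Hk1 : k = 1%Z) by (rewrite <- Hl1; now apply (same_winding th phi L)).
(* Speed over turning rate is the radius of curvature; its maximum is [M]. *)
destruct (periodic_max (fun t => sqrt (N t) / kap t) L HL) as [m Hm].
  intros t; unfold kap; now rewrite PN, Px1, Py1, Px2, Py2.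
  intros t; assert (P : 0 < N t) by apply HN.
  apply continuity_pt_filterlim.
  change (continuous (fun t => sqrt (N t) / kap t) t).
  assert (CN : continuous N t).
    apply (continuous_plus (fun t => x1 t * x1 t) (fun t => y1 t * y1 t));
      [apply (continuous_mult x1 x1)|apply (continuous_mult y1 y1)]; auto.
  apply (continuous_mult (fun t => sqrt (N t)) (fun t => / kap t)).
  - apply continuous_comp; [exact CN|apply continuous_sqrt].
  - apply continuous_comp with (g := Rinv);
      [|apply continuous_Rinv; assert (H := Hkap t); lra].
    apply (continuous_mult (fun t => x1 t * y2 t - y1 t * x2 t) (fun t => / N t)).
    + apply (continuous_minus (fun t => x1 t * y2 t) (fun t => y1 t * x2 t));
        [apply (continuous_mult x1 y2)|apply (continuous_mult y1 x2)]; auto.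
    + apply continuous_comp with (g := Rinv); [exact CN|apply continuous_Rinv; lra].
set (M := sqrt (N m) / kap m) in *.
exists (fun t => sqrt (N t)), (fun t => dir (th t)), (6 * M); split.
- apply turning_frame with (fun t => sqrt (N t)) kap L; auto.
  + apply Rdiv_lt_0_compat; auto.
  + intros t; rewrite <- Ex1; apply Dx.
  + intros t; rewrite <- Ey1; apply Dy.
  + intros t; assert (H := Hm t); assert (P := Hkap t); cbv beta in H; fold M in H.
    apply (Rmult_le_compat_r (kap t)) in H; [|lra].
    unfold Rdiv in H; rewrite Rmult_assoc, Rinv_l, Rmult_1_r in H by lra; exact H.
  + intros t; rewrite Hk, Hk1; ring.
- intros t; split; [apply SN|].
  apply pair_ext; unfold tang; unfold_pt.
  + rewrite <- Ex1; now apply is_derive_unique.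
  + rewrite <- Ey1; now apply is_derive_unique.
Qed.

Theorem theorem4p1 (gx gy : R -> R) (L : R) (O : pt) :
  is_oval gx gy L ->
  in_interior gx gy O ->
  exists C : R,
    forall x : pt, ~ inK gx gy x ->
    forall y z p : pt,
      olb_map gx gy x y -> olb_map gx gy y z -> flow1 gx gy O x p ->
      pdist z p <= C / pdist x O.
Proof.
intros Hoval Hint.
destruct (oval_frame gx gy L O Hoval Hint) as (q & e & M & HF & HT).
destruct (framed_oval_estimate gx gy q e M O HF HT) as [C HC].
exists C; intros x _; apply HC.
Qed.
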